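(* Let $\alpha$ be a quadratic rational curve on $\mathrm{O}_{n,1}(\mathbb{R})$ with poles at $\pm\mathsf{i}$ and $\alpha(\infty)=I_{n+1}$. Put $$Q_3=\begin{bmatrix}0&\frac{\sqrt2}{2}&-\frac{\sqrt2}{2}\\1&0&0\\0&-\frac{\sqrt2}{2}&-\frac{\sqrt2}{2}\end{bmatrix}.$$ Then $\alpha$ is one of the following: (i) There exist $P\in\mathrm{O}_{n,1}(\mathbb{R})$, an integer $0\le r\le n/2$ and a quadratic rational curve $\beta$ on $\mathrm{O}_{2r}(\mathbb{R})$ with poles at $\pm\mathsf{i}$ satisfying $\mathrm{rank}(\beta'(0))=2r$ such that $$\alpha(t)=P\begin{bmatrix}\beta(t)&0\\0&I_{n+1-2r}\end{bmatrix}P^{-1}.$$ (ii) There exist $P\in\mathrm{O}_{n,1}(\mathbb{R})$, an integer $0\le r\le(n-3)/2$, a unit vector $y\in\mathbb{S}^{n-2r-3}\subseteq\mathbb{R}^{n-2r-2}$, and a quadratic rational curve $\beta$ on $\mathrm{O}_{2r}(\mathbb{R})$ with poles at $\pm\mathsf{i}$ satisfying $\mathrm{rank}(\beta'(0))=2r$ such that $$\alpha(t)=P\begin{bmatrix}I_{n-2}&0\\0&Q_3^{\mathsf T}\end{bmatrix}\begin{bmatrix}\beta(t)&0&0&0&0\\0&I_{n-2r-2}&\frac{y}{t^2+1}&0&0\\0&0&1&0&0\\0&0&\frac{t}{t^2+1}&1&0\\0&\frac{y^{\mathsf T}}{t^2+1}&\frac{1}{2(t^2+1)}&\frac{t}{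t^2+1}&1\end{bmatrix}\begin{bmatrix}I_{n-2}&0\\0&Q_3\end{bmatrix}P^{-1}.$$
   Context: $\mathrm{O}_{n,1}(\mathbb{R})=\{X\in\mathrm{GL}_{n+1}(\mathbb{R}):X I_{n,1}X^{\mathsf T}=I_{n,1}\}$ with $I_{n,1}=\mathrm{diag}(I_n,-1)$ (equivalently $X^{\mathsf T}I_{n,1}X=I_{n,1}$); $\mathrm{O}_m(\mathbb{R})$ is the real orthogonal group; $\mathsf{i}$ is the complex unit; $\mathbb{S}^{k-1}$ is the unit sphere of $\mathbb{R}^k$. A rational curve on a real linear group $G\subseteq\mathbb{R}^{N\times N}$ is a map $\gamma(t)=P(t)/q(t)$, with $q\in\mathbb{R}[t]$ having no real root, $P\in\mathbb{R}[t]^{N\times N}$, $q$ and the entries of $P$ having gcd $1$, $\gamma(t)\in G$ for all real $t$, and $\gamma(+\infty)=\gamma(-\infty)\in G$. Its degree is $\deg q$ (quadratic means degree $2$) and its poles are the complex roots of $q$. For $r=0$ the block $\beta$ is empty. *)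

(* Defs.v *)
From HB Require Import structures.
From mathcomp Require Import all_boot all_order all_algebra zify.
From mathcomp Require Import complex.
From mathcomp Require Import all_classical all_reals all_analysis.
Import Order.TTheory GRing.Theory Num.Theory numFieldNormedType.Exports.

Set Implicit Arguments.
Unset Strict Implicit.
Unset Printing Implicit Defensive.

Local Open Scope classical_set_scope.
Local Open Scope complex_scope.
Local Open Scope ring_scope.

Definition orthogonal_group (R : realType) (m : nat) : set 'M[R]_m :=
  [set X | X \in unitmx /\ X *m X^T = 1%:M].

Definition lorentz_form (R : realType) (n : nat) : 'M[R]_(n + 1) :=
  block_mx 1%:M 0 0 (- 1%:M).

Definition lorentz_group (R : realType) (n : nat) : set 'M[R]_(n + 1) :=
  [set X | X \in unitmx /\ X *m lorentz_form R n *m X^T = lorentz_form R n].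

Definition unit_sphere (R : realType) (k : nat) : set 'cV[R]_k :=
  [set y | \sum_i y i 0 ^+ 2 = 1].

Definition value_at_infty (R : realType) (N : nat)
    (gamma : R -> 'M[R]_N) (L : 'M[R]_N) : Prop :=
  gamma t @[t --> +oo] --> L /\ gamma t @[t --> -oo] --> L.

(* Numerator and denominator are determined by the underlying map only up to a
   common nonzero constant, which changes neither the degree nor the poles. *)
Record rational_curve (R : realType) (N : nat) (G : set 'M[R]_N) := RationalCurve {
  curve_num : 'M[{poly R}]_N;
  curve_den : {poly R};
  curve_fun :> R -> 'M[R]_N :=
    fun t => (curve_den.[t])^-1 *: map_mx (horner^~ t) curve_num;
  curve_den_noroot : forall t : R, ~~ root curve_den t;
  curve_coprime :
    coprimep curve_den (\big[@gcdp R/0]_i \big[@gcdp R/0]_j curve_num i j);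
  curve_in_group : forall t : R, G (curve_fun t);
  curve_at_infty : exists2 L, G L & value_at_infty curve_fun L }.

Definition curve_degree (R : realType) (N : nat) (G : set 'M[R]_N)
    (gamma : rational_curve G) : nat :=
  (size (curve_den gamma)).-1.

Definition curve_poles (R : realType) (N : nat) (G : set 'M[R]_N)
    (gamma : rational_curve G) : set R[i] :=
  [set z | root (map_poly (real_complex R) (curve_den gamma)) z].

(* Pitfall: for N = 0 there are no entries, so coprimality makes the denominator
   constant and this predicate fails; an empty block must not be required to
   satisfy it. *)
Definition quadratic_with_poles_i (R : realType) (N : nat) (G : set 'M[R]_N)
    (gamma : rational_curve G) : Prop :=
  curve_degree gamma = 2%N /\ curve_poles gamma = [set 'i%C; - 'i%C].

Definition Q3 (R : realType) : 'M[R]_3 :=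
  let a := Num.sqrt 2 / 2 in
  \matrix_(i < 3, j < 3)
    (nth [::] [:: [:: 0;   a; - a];
                  [:: 1;   0;   0];
                  [:: 0; - a; - a]] i)`_j.

Section Blocks.
Variables (R : realType) (n r : nat).

Lemma dim_compact : (2 * r <= n)%N -> (2 * r + (n + 1 - 2 * r) = n + 1)%N.
Proof. by lia. Qed.

Lemma dim_parabolic : (2 * r + 3 <= n)%N ->
  (2 * r + (n - 2 * r - 2 + (1 + (1 + 1))) = n + 1)%N.
Proof. by lia. Qed.

Lemma dim_Q3 : (2 * r + 3 <= n)%N -> (n - 2 + 3 = n + 1)%N.
Proof. by lia. Qed.

Definition compact_block (hr : (2 * r <= n)%N) (B : 'M[R]_(2 * r)) :
    'M[R]_(n + 1) :=
  castmx (dim_compact hr, dim_compact hr) (block_mx B 0 0 1%:M).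

Definition Q3_block (hr : (2 * r + 3 <= n)%N) : 'M[R]_(n + 1) :=
  castmx (dim_Q3 hr, dim_Q3 hr) (block_mx 1%:M 0 0 (Q3 R)).

Definition Q3_tr_block (hr : (2 * r + 3 <= n)%N) : 'M[R]_(n + 1) :=
  castmx (dim_Q3 hr, dim_Q3 hr) (block_mx 1%:M 0 0 (Q3 R)^T).

Definition parabolic_block (hr : (2 * r + 3 <= n)%N) (B : 'M[R]_(2 * r))
    (y : 'cV[R]_(n - 2 * r - 2)) (t : R) : 'M[R]_(n + 1) :=
  let s := (t ^+ 2 + 1)^-1 in
  let row5 (p : nat) (A1 : 'M[R]_(p, 2 * r)) (A2 : 'M[R]_(p, n - 2 * r - 2))
      (A3 A4 A5 : 'M[R]_(p, 1)) :=
    row_mx A1 (row_mx A2 (row_mx A3 (row_mx A4 A5))) in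
  castmx (dim_parabolic hr, dim_parabolic hr)
    (col_mx (row5 _ B 0          0               0            0)
    (col_mx (row5 _ 0 1%:M       (s *: y)        0            0)
    (col_mx (row5 _ 0 0          1%:M            0            0)
    (col_mx (row5 _ 0 0          (t * s)%:M      1%:M         0)
            (row5 _ 0 (s *: y^T) (2^-1 * s)%:M   (t * s)%:M   1%:M))))).

End Blocks.

(* Main.v *)
Require Import Defs.
From HB Require Import structures.
From mathcomp Require Import all_boot all_order all_algebra.
From mathcomp Require Import complex polyrcf zify ring lra.
From mathcomp Require Import all_classical all_reals all_analysis.
Import Order.TTheory GRing.Theory Num.Theory numFieldNormedType.Exports.

(* A quadratic curve with poles at i and -i and value 1 at infinity is
   alpha = 1 + (t A + B) / (t^2 + 1). Lying on the isometry group of a form <x, y>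
   means that A and K = B - A^2 / 2 are skew, A K = - K A and K^2 = A^4 / 4 + A^2.
   Hence <x K, x A> = 0 and q (x K) = q (x A) - q (x A^2) / 4, where q x = <x, x>. For a
   Lorentzian form this makes q nonnegative on the image of A: were x A timelike, so
   would be x K, but two timelike vectors are never orthogonal.
   If q is definite on the image of A, then the kernel of A contains a timelike vector,
   K kills it, and A and K live on its spacelike complement. Otherwise there is a null
   vector u = w A; then u A = u K = 0, u is orthogonal to the kernel of A^2, so
   u = f A^2 for some f, and, after rescaling and moving f along u, the vectors
   u, g = f A, f span a nondegenerate A-invariant subspace with f K a unit vector in
   ker A of its spacelike complement.
   On the spacelike part, A is skew, hence invertible on its image, of even dimension,
   which K preserves. Matrices act on row vectors from the right throughout, so that
   the rows of P^-1 are the adapted basis. *)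

Set Implicit Arguments.
Unset Strict Implicit.
Unset Printing Implicit Defensive.

Local Open Scope classical_set_scope.
Local Open Scope ring_scope.

(** * Orthonormal families for symmetric bilinear forms *)

Definition bform (R : pzRingType) (N : nat) (S : 'M[R]_N) (x y : 'rV[R]_N) : R :=
  (x *m S *m y^T) 0 0.

Lemma dot_gt0 (R : realDomainType) m (a : 'rV[R]_m) : a != 0 -> 0 < (a *m a^T) 0 0.
Proof.
have sq i : a 0 i * a^T i 0 = a 0 i ^+ 2 by rewrite [a^T _ _]mxE expr2.
move=> a0; rewrite mxE lt_neqAle sumr_ge0 ?andbT; last by move=> i _; rewrite sq sqr_ge0.
rewrite eq_sym psumr_eq0; last by move=> i _; rewrite sq sqr_ge0.
apply: contra a0 => /allP a0; apply/eqP/rowP => i; rewrite [RHS]mxE; apply/eqP.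
by have := a0 i (mem_index_enum i); rewrite sq sqrf_eq0.
Qed.

Section Form.
Variables (R : rcfType) (N : nat) (S : 'M[R]_N).
Hypothesis S_sym : S^T = S.

Local Notation "[< x , y >]" := (bform S x y) (format "[< x ,  y >]").

Lemma bformDl x y z : [<x + y, z>] = [<x, z>] + [<y, z>].
Proof. by rewrite /bform !mulmxDl mxE. Qed.

Lemma bformZl c x z : [<c *: x, z>] = c * [<x, z>].
Proof. by rewrite /bform -!scalemxAl mxE. Qed.

Lemma bformC x y : [<x, y>] = [<y, x>].
Proof.
by rewrite /bform -[in LHS]trace_mx11 -mxtrace_tr trace_mx11 !trmx_mul trmxK S_sym mulmxA.
Qed.

Lemma bformDr x y z : [<x, y + z>] = [<x, y>] + [<x, z>].
Proof. by rewrite bformC bformDl !(bformC x). Qed.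

Lemma bformZr c x z : [<x, c *: z>] = c * [<x, z>].
Proof. by rewrite bformC bformZl bformC. Qed.

Lemma bform0l x : [<0, x>] = 0.
Proof. by rewrite /bform !mul0mx mxE. Qed.

Lemma bformNl x y : [<- x, y>] = - [<x, y>].
Proof. by rewrite -scaleN1r bformZl mulN1r. Qed.

Lemma bform_eq0 x y : [<x, y>] = 0 <-> x *m S *m y^T = 0.
Proof.
split=> [h|h]; last by rewrite /bform h mxE.
by rewrite [LHS]mx11_scalar -/(bform S x y) h raddf0.
Qed.

Lemma bform_skew M x y : M *m S = - (S *m M^T) -> [<x *m M, y>] = - [<x, y *m M>].
Proof.
by move=> h; rewrite /bform trmx_mul -(mulmxA x) h mulmxN mulNmx !mulmxA [LHS]mxE.
Qed.

Lemma bform_skew0 M x : M *m S = - (S *m M^T) -> [<x *m M, x>] = 0.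
Proof. by move=> /bform_skew h; have := h x x; rewrite (bformC x); lra. Qed.

Lemma bform_add x y : [<x, y>] = 0 -> [<x + y, x + y>] = [<x, x>] + [<y, y>].
Proof. by move=> xy; rewrite bformDl !bformDr (bformC y) xy addr0 add0r. Qed.

(** Gram-Schmidt: normalise a nonzero row x of W, subtract from every row of W its projection on x,
    which lowers the rank by at most one, and recurse on the result. *)
Lemma orthonormal_family m p (W : 'M[R]_(p, N)) :
    (forall x : 'rV_N, (x <= W)%MS -> x != 0 -> 0 < [<x, x>]) ->
    (m <= \rank W)%N ->
  exists2 U : 'M[R]_(m, N), U *m S *m U^T = 1%:M & (U <= W)%MS.
Proof.
elim: m p W => [|m IHm] p W posW leW.
  by exists 0; [rewrite [LHS]flatmx0 flatmx0 | rewrite sub0mx].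
have W0 : W != 0 by apply: contraTneq leW => ->; rewrite mxrank0.
set x0 := nz_row W.
have x0W : (x0 <= W)%MS by apply: nz_row_sub.
have q0 : 0 < [<x0, x0>] by apply: posW => //; rewrite nz_row_eq0.
pose x := (Num.sqrt [<x0, x0>])^-1 *: x0.
have xW : (x <= W)%MS by apply: scalemx_sub.
have qx : x *m S *m x^T = 1%:M.
  rewrite [LHS]mx11_scalar -/(bform S x x) bformZl bformZr mulrA -expr2 exprVn.
  by rewrite sqr_sqrtr ?ltW // mulVf ?gt_eqF.
pose c := W *m S *m x^T; pose W' := W - c *m x.
have WW' : (W' <= W)%MS.
  by rewrite addmx_sub // eqmx_opp (submx_trans (submxMl _ _)).
have W'x : W' *m S *m x^T = 0.
  by rewrite /W' !mulmxBl -!mulmxA [x *m _]mulmxA qx mulmx1 /c mulmxA subrr.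
have leW' : (m <= \rank W')%N.
  have := mxrank_add W' (c *m x); rewrite subrK => /(leq_trans leW) h.
  rewrite -(leq_add2r 1) addn1; apply: leq_trans h _.
  by rewrite leq_add2l (leq_trans (mxrankM_maxr _ _)) // rank_leq_row.
have [|U oU UW'] := IHm _ W' _ leW'.
  by move=> z zW'; apply: posW; apply: submx_trans WW'.
have [X defU] := submxP UW'.
have Ux : U *m S *m x^T = 0 by rewrite defU -!mulmxA [W' *m _]mulmxA W'x mulmx0.
have xU : x *m S *m U^T = 0.
  by apply: trmx_inj; rewrite !trmx_mul trmxK S_sym mulmxA Ux trmx0.
have V1 : col_mx x U *m S *m (col_mx x U)^T = 1%:M.
  by rewrite tr_col_mx mul_col_mx mul_col_row qx Ux xU oU -scalar_mx_block.
have V2 : (col_mx x U <= W)%MS by rewrite col_mx_sub xW (submx_trans UW').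
by exists (col_mx x U).
Qed.

Lemma orthonormal_rank m (U : 'M[R]_(m, N)) : U *m S *m U^T = 1%:M -> \rank U = m.
Proof.
move=> oU; apply/eqP; rewrite eqn_leq rank_leq_row -{1}(mxrank1 R m) -oU -mulmxA.
exact: mxrankM_maxl.
Qed.

Lemma orthonormal_eqmx m p (U : 'M[R]_(m, N)) (W : 'M[R]_(p, N)) :
  U *m S *m U^T = 1%:M -> (U <= W)%MS -> \rank W = m -> (W <= U)%MS.
Proof.
move=> oU UW rW; rewrite -(geq_leqif (mxrank_leqif_sup UW)).
by rewrite (orthonormal_rank oU) rW.
Qed.

(** The invertible Gram matrix of T forces [S *m T^T] to have rank k, so its kernel, the orthogonal
    complement of T, has rank exactly m and is spanned by an orthonormal family of that length. *)
Lemma orthonormal_complement m k (T : 'M[R]_(k, N)) :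
    (m + k = N)%N -> T *m S *m T^T \in unitmx ->
    (forall x : 'rV_N, T *m S *m x^T = 0 -> x != 0 -> 0 < [<x, x>]) ->
  exists E : 'M[R]_(m, N), [/\ E *m S *m E^T = 1%:M, T *m S *m E^T = 0 &
    forall p (X : 'M[R]_(p, N)), T *m S *m X^T = 0 -> (X <= E)%MS].
Proof.
move=> dimN uT posT.
have kerT p (X : 'M[R]_(p, N)) : (X <= kermx (S *m T^T))%MS <-> T *m S *m X^T = 0.
  split=> [/sub_kermxP h|h]; last apply/sub_kermxP; apply: trmx_inj;
    by rewrite !trmx_mul trmxK S_sym ?h ?mulmxA ?trmx0.
have rkT : \rank (S *m T^T) = k.
  apply/eqP; rewrite eqn_leq rank_leq_col -{1}(mxrank_unit uT) -mulmxA.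
  exact: mxrankM_maxr.
have rkK : \rank (kermx (S *m T^T)) = m.
  by rewrite mxrank_ker rkT -[X in (X - k)%N]dimN addnK.
have [||E oE ET] := @orthonormal_family m _ (kermx (S *m T^T)).
- by move=> x /kerT; apply: posT.
- by rewrite rkK.
exists E; split=> //; first exact/kerT.
by move=> p X /kerT XK; apply: submx_trans XK (orthonormal_eqmx oE ET rkK).
Qed.

End Form.

(** * Splitting a skew map into its image and its kernel *)

Lemma skew_unit_even (F : numFieldType) k (C : 'M[F]_k) :
  C^T = - C -> C \in unitmx -> ~~ odd k.
Proof.
move=> CT; rewrite unitmxE unitfE; apply: contraNN => oddk.
(* C and its transpose have the same determinant, and an odd size pulls one sign out of det(-C). *)
have : \det C = - \det C.
  by rewrite -{1}det_tr CT -scaleN1r detZ -signr_odd oddk expr1 mulN1r.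
by move/eqP; rewrite -addr_eq0 -mulr2n mulrn_eq0.
Qed.

Section Split.
Variables (R : rcfType) (N : nat) (S : 'M[R]_N).
Hypothesis S_sym : S^T = S.
Local Notation "[< x , y >]" := (bform S x y) (format "[< x ,  y >]").

Lemma orthonormal_pos m (E : 'M[R]_(m, N)) (x : 'rV_N) :
  E *m S *m E^T = 1%:M -> (x <= E)%MS -> x != 0 -> 0 < [<x, x>].
Proof.
move=> oE /submxP[a ->] aE.
have -> : [<a *m E, a *m E>] = (a *m (E *m S *m E^T) *m a^T) 0 0.
  by rewrite /bform trmx_mul !mulmxA.
rewrite oE mulmx1; apply: dot_gt0; apply: contraNneq aE => ->.
by rewrite mul0mx.
Qed.

(** U is an orthonormal basis of the image of E under A and V one of the kernel of A inside E.
    Skewness makes them orthogonal, rank-nullity makes them fill E, and the invertible skew matrix C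
    of A on U forces the number of rows of U to be even. *)
Lemma skew_split (A : 'M[R]_N) m (E : 'M[R]_(m, N)) :
    A *m S = - (S *m A^T) -> E *m S *m E^T = 1%:M -> (E *m A <= E)%MS ->
  exists (r l : nat) (U : 'M[R]_(2 * r, N)) (V : 'M[R]_(l, N)) (C : 'M[R]_(2 * r)),
  [/\ (2 * r + l = m)%N,
      [/\ U *m S *m U^T = 1%:M, V *m S *m V^T = 1%:M & U *m S *m V^T = 0],
      [/\ U *m A = C *m U, C \in unitmx & V *m A = 0],
      (U <= E *m A)%MS /\ (E *m A <= U)%MS &
      (V <= E)%MS /\ forall z : 'rV_N, (z <= E)%MS -> z *m A = 0 -> (z <= V)%MS].
Proof.
move=> A_skew oE EA; set D := E *m A.
have posE x := orthonormal_pos (x := x) oE.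
have freeE : row_free E by rewrite /row_free (orthonormal_rank oE).
have [k rkD] : exists k, \rank D = k by eexists.
have [l rkK] : exists l, \rank (kermx D *m E) = l by eexists.
have dimE : (k + l = m)%N.
  by rewrite -rkK mxrankMfree // mxrank_ker rkD subnKC // -rkD rank_leq_row.
have [||U oU UD] := @orthonormal_family _ _ S S_sym k _ D.
- by move=> x xD; apply: posE; apply: submx_trans EA.
- by rewrite rkD.
have [||V oV VK] := @orthonormal_family _ _ S S_sym l _ (kermx D *m E).
- by move=> x xD; apply: posE; apply: submx_trans xD (submxMl _ _).
- by rewrite rkK.
have DU := orthonormal_eqmx oU UD rkD.
have KV := orthonormal_eqmx oV VK rkK.
have [C UC] : exists C, U *m A = C *m U.
  apply/submxP; apply: submx_trans DU; rewrite /D; apply: submxMr.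
  exact: submx_trans UD EA.
have VA : V *m A = 0.
  have kA : kermx D *m E *m A = 0 by rewrite -mulmxA mulmx_ker.
  by have [Y ->] := submxP VK; rewrite -mulmxA kA mulmx0.
have [X UX] := submxP UD.
have UV : U *m S *m V^T = 0.
  rewrite UX /D -!mulmxA [A *m _]mulmxA A_skew mulNmx -mulmxA -trmx_mul VA.
  by rewrite trmx0 !(mulmx0, oppr0).
have C_unit : C \in unitmx.
  rewrite -row_free_unit -kermx_eq0; apply/rowV0P => x /sub_kermxP xC.
  have xUA : x *m U *m A = 0 by rewrite -mulmxA UC mulmxA xC mul0mx.
  have xU0 : x *m U = 0.
    apply/eqP; apply: contraT => xU.
    have : 0 < [<x *m U, x *m U>].
      by apply: posE => //; rewrite (submx_trans (submxMl _ _)) // (submx_trans UD).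
    (* The vector x U lies in the image of A and is killed by A. Moving A across the form shows that
       it is orthogonal to itself. *)
    rewrite {1}UX /D !mulmxA (bform_skew _ _ A_skew) xUA bformC // bform0l oppr0.
    by rewrite ltxx.
  by rewrite -[x]mulmx1 -oU !mulmxA xU0 !mul0mx.
(* Orthonormality of U recovers C as U A S U^T, which inherits the skewness of A. *)
have C_skew : C^T = - C.
  have CE : C = U *m A *m S *m U^T by rewrite UC -!mulmxA [U *m _]mulmxA oU mulmx1.
  rewrite CE !trmx_mul trmxK S_sym -!mulmxA -mulmxN; congr (_ *m _).
  by rewrite !mulmxA -mulNmx A_skew opprK.
have kE := skew_unit_even C_skew C_unit.
have ker_le z : (z <= E)%MS -> z *m A = 0 -> (z <= V)%MS.
  move=> /submxP[a ->] aEA; apply: submx_trans KV; apply: submxMr.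
  by apply/sub_kermxP; rewrite mulmxA.
have VE : (V <= E)%MS by apply: submx_trans VK (submxMl _ _).
have [r rE] : exists r, k = (2 * r)%N by exists k./2; rewrite mul2n even_halfK.
clear X UX C_skew kE rkD rkK; subst k.
exists r, l, U, V, C; split=> //.
by split=> // z; apply: ker_le.
Qed.

End Split.

(* The Gram matrix of u, g, f with u and f null, <u, f> = -1, and g a unit vector
   orthogonal to both. *)
Definition null_gram (F : pzRingType) : 'M[F]_3 :=
  \matrix_(i, j) if (i + j == 2)%N then (if i == 1 then 1 else -1) else 0.

Lemma null_gramK (F : pzRingType) : null_gram F *m null_gram F = 1%:M.
Proof.
apply/matrixP => -[[|[|[|//]]] i] [[|[|[|//]]] j];
  by rewrite !mxE !big_ord_recl big_ord0 !mxE /= ?(mulr0, mul0r, mulr1, mulrNN, addr0, add0r).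
Qed.

(** * The matrix [Q3] and the Lorentz form in dimension three *)

Lemma lorentz_formE (R : realType) n :
  lorentz_form R n = \matrix_(i, j) ((if (i < n)%N then 1 else -1) *+ (i == j)).
Proof.
apply/matrixP => i j; rewrite !mxE; case: splitP => a ai; rewrite !mxE;
  case: splitP => b bj; rewrite !mxE -!val_eqE /= ai bj ?ltn_ord ?(ltn_ord b).
- by [].
- by rewrite ltn_eqF ?ltn_addr.
- by rewrite gtn_eqF ?ltn_addr.
- by rewrite (ord1 a) (ord1 b) !eqxx.
Qed.

Lemma sqr_half_sqrt2 (R : realType) : Num.sqrt 2 / 2 * (Num.sqrt 2 / 2) = 2^-1 :> R.
Proof. by rewrite mulrACA -[X in X * _]expr2 sqr_sqrtr //; field. Qed.

(** The rows of [Q3] are a null frame of the standard form. As [Q3] is also orthogonal, its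
    transpose carries any null frame to a Lorentz-orthonormal one. *)
Lemma Q3_gram (R : realType) : Q3 R *m lorentz_form R 2 *m (Q3 R)^T = null_gram R.
Proof.
have h := sqr_half_sqrt2 R.
rewrite lorentz_formE; apply/matrixP => -[[|[|[|//]]] i] [[|[|[|//]]] j];
  rewrite !mxE !big_ord_recl big_ord0 !mxE /= !big_ord_recl !big_ord0 !mxE /=;
  by rewrite ?(mulr0, mul0r, mulr1, addr0, add0r, mulrN, mulNr, h); lra.
Qed.

Lemma Q3_orthogonal (R : realType) : Q3 R *m (Q3 R)^T = 1%:M.
Proof.
have h := sqr_half_sqrt2 R.
apply/matrixP => -[[|[|[|//]]] i] [[|[|[|//]]] j];
  rewrite !mxE !big_ord_recl big_ord0 !mxE /=;
  by rewrite ?(mulr0, mul0r, mulr1, addr0, add0r, mulrN, mulNr, opprK, h); lra.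
Qed.

Lemma null_frame_gram (R : rcfType) N (S : 'M[R]_N) (u g f : 'rV_N) :
    S^T = S ->
    [/\ bform S u u = 0, bform S u g = 0 & bform S u f = -1] ->
    [/\ bform S g g = 1, bform S g f = 0 & bform S f f = 0] ->
  col_mx u (col_mx g f) *m S *m (col_mx u (col_mx g f))^T = null_gram R.
Proof.
move=> S_sym [uu ug uf] [gg gf ff]; set T := col_mx u _.
have rowT (i : 'I_3) : row i T = nth 0 [:: u; g; f] i.
  apply/rowP => k; rewrite !mxE.
  case: splitP => a ->; first by rewrite (ord1 a).
  rewrite mxE; case: splitP => b ->; first by rewrite (ord1 b).
  by rewrite (ord1 b).
have entry (i j : 'I_3) : (T *m S *m T^T) i j = bform S (row i T) (row j T).
  rewrite /bform -row_mul !mxE; apply: eq_bigr => k _; rewrite !mxE; congr (_ * _).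
apply/matrixP => i j; rewrite entry !rowT mxE.
by case: i j => [[|[|[|//]]] i] [[|[|[|//]]] j] //=; rewrite bformC.
Qed.

(** * Frames adapted to a curve in the isometry group of a Lorentzian form *)

Section Frame.
Variables (R : rcfType) (N : nat) (S : 'M[R]_N).
Hypothesis S_sym : S^T = S.
Hypothesis S_unit : S \in unitmx.
Local Notation "[< x , y >]" := (bform S x y) (format "[< x ,  y >]").

(** Signature (n, 1) without coordinates: a negative semidefinite subspace is at most a line. *)
Hypothesis lorentzian : forall v x : 'rV[R]_N,
  v != 0 -> [<v, v>] <= 0 -> [<x, x>] <= 0 -> [<x, v>] = 0 ->
  exists c, x = c *: v.
Hypothesis timelike : exists v : 'rV[R]_N, [<v, v>] < 0.

Variables A K : 'M[R]_N.
Hypothesis A_skew : A *m S = - (S *m A^T).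
Hypothesis K_skew : K *m S = - (S *m K^T).
Hypothesis AK : A *m K = - (K *m A).
Hypothesis KK : K *m K = 4^-1 *: (A *m A *m (A *m A)) + A *m A.

Lemma bform_timelike v x : [<v, v>] < 0 -> [<x, v>] = 0 -> x != 0 -> 0 < [<x, x>].
Proof.
move=> qv xv; apply: contraNT; rewrite -leNgt => qx.
have v0 : v != 0 by apply: contraTneq qv => ->; rewrite bform0l ltxx.
have [c xE] := lorentzian v0 (ltW qv) qx xv.
move: xv; rewrite xE bformZl => /eqP; rewrite mulf_eq0 (lt_eqF qv) orbF => /eqP ->.
by rewrite scale0r.
Qed.

Lemma bform_null_ge0 v x : v != 0 -> [<v, v>] = 0 -> [<x, v>] = 0 -> 0 <= [<x, x>].
Proof.
move=> v0 qv xv; rewrite leNgt; apply/negP => qx.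
have [|c xE] := lorentzian v0 _ (ltW qx) xv; first by rewrite qv.
by move: qx; rewrite xE bformZl bformZr // qv !mulr0 ltxx.
Qed.

(** The number <x K A, x> equals - <x K, x A> by skewness of A, and + <x K, x A> by skewness of K
    and anticommutation. *)
Lemma bform_KA x : [<x *m K, x *m A>] = 0.
Proof.
have := bform_skew (x *m K) x A_skew; rewrite -mulmxA.
have := bform_skew (x *m A) x K_skew; rewrite -mulmxA AK mulmxN bformNl mulmxA.
rewrite (bformC S_sym (x *m A)); move: (bform S (x *m K) _) (bform S (x *m K *m A) _).
by move=> a b; lra.
Qed.

Lemma bform_KK x :
  [<x *m K, x *m K>] = [<x *m A, x *m A>] - 4^-1 * [<x *m A *m A, x *m A *m A>].
Proof.
rewrite (bform_skew _ _ K_skew) -!mulmxA KK mulmxDr -scalemxAr bformDr // bformZr //.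
by rewrite !mulmxA !(bform_skew _ _ A_skew) !opprK; lra.
Qed.

Lemma bform_A_ge0 x : 0 <= [<x *m A, x *m A>].
Proof.
rewrite leNgt; apply/negP => qA.
(* Since A is skew, x A^2 is orthogonal to the timelike x A, hence zero or spacelike. Then x K is
   timelike as well, yet orthogonal to x A. *)
have A20 : 0 <= [<x *m A *m A, x *m A *m A>].
  have [->|/(bform_timelike qA) h] := eqVneq (x *m A *m A) 0; first by rewrite bform0l.
  by rewrite ltW // h // bform_skew0.
have qK : [<x *m K, x *m K>] < 0 by rewrite bform_KK; lra.
have /(bform_timelike qA (bform_KA x)) h : x *m K != 0.
  by apply: contraTneq qK => ->; rewrite bform0l ltxx.
by move: h; rewrite ltNge ltW.
Qed.

(** Skewness puts e K in the orthogonal complement of e, which is positive definite, while e A = 0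
    gives q (e K) = 0. *)
Lemma mulK0_timelike e : [<e, e>] < 0 -> e *m A = 0 -> e *m K = 0.
Proof.
move=> qe eA; apply/eqP; apply: contraT => eK.
have := bform_timelike qe (bform_skew0 S_sym e K_skew) eK.
by rewrite bform_KK eA mul0mx bform0l mulr0 subr0 ltxx.
Qed.

(** Take a timelike v and remove its projection on the image of A. The image being positive
    definite, the remainder is still timelike, and being orthogonal to the image means, by skewness,
    being killed by A. *)
Lemma timelike_kernel :
    (forall x : 'rV[R]_N, x *m A != 0 -> 0 < [<x *m A, x *m A>]) ->
  exists e : 'rV[R]_N, [/\ e *m S *m e^T = - 1%:M, e *m A = 0 & e *m K = 0].
Proof.
move=> posA.
have [|U oU UA] := @orthonormal_family _ _ S S_sym _ _ A _ (leqnn _).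
  by move=> _ /submxP[x ->]; apply: posA.
have [X defA] : exists X, A = X *m U.
  apply/submxP; rewrite -(geq_leqif (mxrank_leqif_sup UA)).
  by rewrite (orthonormal_rank oU).
have [v qv] := timelike.
pose a := v *m S *m U^T; pose e0 := v - a *m U.
have e0U : e0 *m S *m U^T = 0.
  by rewrite !mulmxBl -!mulmxA [U *m _]mulmxA oU mulmx1 /a !mulmxA subrr.
have e0A : e0 *m A = 0.
  apply: (can_inj (mulmxK S_unit)); rewrite mul0mx -mulmxA A_skew mulmxN mulmxA.
  by rewrite defA trmx_mul mulmxA e0U mul0mx oppr0.
have qe0 : [<e0, e0>] < 0.
  have h : [<e0, a *m U>] = 0 by apply/bform_eq0; rewrite trmx_mul mulmxA e0U mul0mx.
  move: qv; rewrite -[v](subrK (a *m U)) -/e0 bform_add //.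
  suff : 0 <= bform S (a *m U) (a *m U) by lra.
  have -> : [<a *m U, a *m U>] = (a *m (U *m S *m U^T) *m a^T) 0 0.
    by rewrite /bform trmx_mul !mulmxA.
  rewrite oU mulmx1.
  by rewrite mxE sumr_ge0 // => i _; rewrite [a^T _ _]mxE -expr2 sqr_ge0.
pose e := (Num.sqrt (- [<e0, e0>]))^-1 *: e0.
have qe : [<e, e>] = -1.
  rewrite bformZl bformZr // mulrA -expr2 exprVn sqr_sqrtr; last by rewrite oppr_ge0 ltW.
  by rewrite invrN mulNr mulVf // lt_eqF.
have eA : e *m A = 0 by rewrite -scalemxAl e0A scaler0.
exists e; split=> //; last by apply: mulK0_timelike => //; rewrite qe ltrN10.
by rewrite [LHS]mx11_scalar -/(bform S e e) qe raddfN.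
Qed.

Lemma null_frame w : w *m A != 0 -> [<w *m A, w *m A>] <= 0 ->
  exists u g f : 'rV[R]_N,
  [/\ [/\ [<u, u>] = 0, [<u, g>] = 0 & [<u, f>] = -1],
      [/\ [<g, g>] = 1, [<g, f>] = 0 & [<f, f>] = 0],
      [/\ f *m A = g, g *m A = u & u *m A = 0],
      [/\ u *m K = 0, g *m K = 0 & f *m K *m K = u] &
      [/\ [<f *m K, u>] = 0, [<f *m K, g>] = 0, [<f *m K, f>] = 0,
          [<f *m K, f *m K>] = 1 & f *m K *m A = 0]].
Proof.
move uE : (w *m A) => u u0 qu_le.
have qu : [<u, u>] = 0 by apply/le_anti; rewrite qu_le -uE bform_A_ge0.
have null_col x : [<x, x>] <= 0 -> [<x, u>] = 0 -> exists c, x = c *: u.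
  by move=> qx xu; apply: lorentzian; rewrite ?qu.
(* Both A and K preserve the null line of u; their eigenvalues d and c there satisfy
   c d = 0 by anticommutation and c^2 = d^4 / 4 + d^2, so both vanish. *)
have [uA uK] : u *m A = 0 /\ u *m K = 0.
  (* As w A = u is null, q (w K) = - q (u A) / 4. Both q (w K) and q (u A) are nonnegative, so u A
     is null. *)
  have qKw : 0 <= [<w *m K, w *m K>] by apply: bform_null_ge0 u0 qu _; rewrite -uE bform_KA.
  have quA : [<u *m A, u *m A>] = 0.
    move: qKw (bform_A_ge0 u); rewrite bform_KK uE qu => h1 h2.
    by move: h1 h2; set q := bform S _ _; lra.
  have [d uA] : exists d, u *m A = d *: u.
    by apply: null_col; rewrite ?quA // bform_skew0.
  have uAA : u *m A *m A = d ^+ 2 *: u by rewrite uA -scalemxAl uA scalerA.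
  have [c uK] : exists c, u *m K = c *: u.
    apply: null_col; last exact: bform_skew0.
    by rewrite bform_KK uAA uA !bformZl !bformZr // qu !mulr0 subr0.
  have cd : c * d = 0.
    have : u *m A *m K = - (u *m K *m A) by rewrite -!mulmxA AK mulmxN.
    rewrite uA uK -!scalemxAl uA uK !scalerA -scaleNr => /eqP.
    rewrite -subr_eq0 -scalerBl scaler_eq0 (negPf u0) orbF => /eqP.
    by lra.
  have cc : c ^+ 2 = 4^-1 * d ^+ 4 + d ^+ 2.
    have : u *m K *m K = 4^-1 *: (u *m A *m A *m A *m A) + u *m A *m A.
      by rewrite -!mulmxA KK mulmxDr -scalemxAr !mulmxA.
    rewrite uAA uK -!scalemxAl uK uAA !scalerA -scalerDl => /eqP.
    rewrite -subr_eq0 -scalerBl scaler_eq0 (negPf u0) orbF subr_eq0 => /eqP.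
    by rewrite [c ^+ 2]expr2 => ->; ring.
  have d0 : d = 0.
    move/eqP: cd; rewrite mulf_eq0 => /orP[/eqP c0|/eqP //].
    by apply/eqP; rewrite -sqrf_eq0; apply/eqP; have := sqr_ge0 (d ^+ 2);
      have := sqr_ge0 d; rewrite -exprM; move: cc; rewrite c0 expr0n /=; lra.
  have c0 : c = 0 by apply/eqP; rewrite -sqrf_eq0 cc d0 !expr0n /= mulr0 addr0.
  by rewrite uA uK d0 c0 !scale0r.
(* Solvability of u = f0 A^2 is tested on the cokernel of A^2. Multiplied by the inverse of S, its
   columns become rows k with k A^2 = 0. Then k A is null and orthogonal to u, so k A = c u, and <u,
   k> = - <w, k A> = - c <w, w A> = 0. *)
have [f0 f0A] : exists f0, u = f0 *m (A *m A).
  apply/submxP; rewrite submxE.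
  pose C := cokermx (A *m A); pose Z := C^T *m invmx S.
  have AAS : invmx S *m (A *m A) = A^T *m A^T *m invmx S.
    apply: (can_inj (mulKmx S_unit)); rewrite mulKVmx // !mulmxA.
    apply: (can_inj (mulmxK S_unit)); rewrite mulmxKV //.
    by rewrite -(mulmxA A) A_skew mulmxN mulmxA A_skew mulNmx opprK.
  have ZA : Z *m A *m A = 0.
    by rewrite -!mulmxA AAS !mulmxA -!trmx_mul mulmxA mulmx_coker trmx0 mul0mx.
  rewrite -/C; have -> : C = S *m Z^T by rewrite trmx_mul trmxK trmx_inv S_sym mulKVmx.
  rewrite mulmxA; apply/eqP/rowP => j; rewrite [RHS]mxE.
  pose k := row j Z.
  have -> : (u *m S *m Z^T) 0 j = [<u, k>].
    by rewrite /bform /k !mxE; apply: eq_bigr => i _; rewrite !mxE.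
  have kAA : k *m A *m A = 0 by rewrite -!row_mul ZA row0.
  have [c kA] : exists c, k *m A = c *: u.
    apply: null_col; last by rewrite bform_skew // uA bformC // bform0l oppr0.
    by rewrite bform_skew // kAA bformC // bform0l oppr0.
  rewrite -{1}uE bform_skew // kA bformZr // -uE bformC // bform_skew0 //.
  by rewrite mulr0 oppr0.
rewrite mulmxA in f0A.
pose g0 := f0 *m A.
have g0u : [<g0, u>] = 0 by rewrite bform_skew // uA bformC // bform0l oppr0.
(* A vector orthogonal to u that is not spacelike lies on the line of u, which A kills, whereas g0 A
   = u is nonzero. *)
have qg0 : 0 < [<g0, g0>].
  rewrite ltNge; apply: contra u0 => /null_col/(_ g0u)[c g0E].
  by rewrite f0A -/g0 g0E -scalemxAl uA scaler0.
(* One scale serves two normalisations: it gives <g, g> = 1, and <f0, u> = - <g0, g0> turns it into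
   <f1, v> = -1. *)
pose a := (Num.sqrt [<g0, g0>])^-1.
have a2 : a * (a * [<g0, g0>]) = 1.
  by rewrite mulrA -expr2 exprVn sqr_sqrtr ?ltW // mulVf // gt_eqF.
have f0u : [<f0, u>] = - [<g0, g0>] by rewrite f0A bformC // bform_skew.
have a0 : a != 0 by rewrite invr_eq0 sqrtr_eq0 -ltNge.
(* Adding b v does not change the image under A and changes the square by 2 b <f1, v> = - 2 b, so
   this b makes f null. *)
pose f1 := a *: f0; pose b := [<f1, f1>] / 2.
pose v := a *: u; pose g := a *: g0; pose f := f1 + b *: v.
have vA : v *m A = 0 by rewrite -scalemxAl uA scaler0.
have vK : v *m K = 0 by rewrite -scalemxAl uK scaler0.
have fA : f *m A = g by rewrite mulmxDl -!scalemxAl uA !scaler0 addr0.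
have gA : g *m A = v by rewrite -scalemxAl -f0A.
have qv : [<v, v>] = 0 by rewrite bformZl bformZr // qu !mulr0.
have f1v : [<f1, v>] = -1 by rewrite bformZl bformZr // f0u !mulrN a2.
have vf : [<v, f>] = -1.
  by rewrite bformC // /f bformDl (bformZl _ b) f1v qv mulr0 addr0.
have gv : [<g, v>] = 0 by rewrite bformZl bformZr // g0u !mulr0.
have gf : [<g, f>] = 0 by rewrite -fA bform_skew0.
have qf : [<f, f>] = 0.
  rewrite {1}/f bformDl (bformZl _ b) vf bformC // /f bformDl (bformZl _ b) (bformC S_sym v) f1v /b.
  by field.
(* By the formula for q (g K), the vector g K is null. It is orthogonal to u, so it is c u, and
   pairing with f gives - <f A, f K> = 0, whence c = 0. *)
have gK : g *m K = 0.
  have [||c gK] := @null_col (g *m K).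
  - by rewrite bform_KK gA qv vA bform0l mulr0 subr0.
  - by rewrite bform_skew // uK bformC // bform0l oppr0.
  have : [<g *m K, f>] = 0 by rewrite bform_skew // -fA bformC // bform_KA oppr0.
  have uf : [<u, f>] != 0.
    have : [<v, f>] != 0 by rewrite vf oppr_eq0 oner_eq0.
    by rewrite bformZl; apply: contraNneq => ->; rewrite mulr0.
  by rewrite gK bformZl => /eqP; rewrite mulf_eq0 (negPf uf) orbF => /eqP ->; rewrite scale0r.
have fKA : f *m K *m A = 0.
  by apply: oppr_inj; rewrite -!mulmxA -mulmxN -AK mulmxA fA gK oppr0.
exists v, g, f; split; split=> //.
- by rewrite bformC.
- by rewrite bformZl bformZr // a2.
- by rewrite -mulmxA KK mulmxDr -scalemxAr !mulmxA fA gA vA mul0mx scaler0 add0r.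
- by rewrite bform_skew // vK bformC // bform0l oppr0.
- by rewrite -fA bform_KA.
- by rewrite bform_skew0.
- by rewrite bform_KK fA gA qv mulr0 subr0 bformZl bformZr.
Qed.

Variable B : 'M[R]_N.
Hypothesis B_def : B = 2^-1 *: (A *m A) + K.

(** Anticommutation turns E A K into - E K A, so K, and with it B, preserves the image of A. Only E
    K A is asked to stay in E A because, in the parabolic case, K itself may move E out along u. *)
Lemma skew_split_stable m (E : 'M[R]_(m, N)) :
    E *m S *m E^T = 1%:M -> (E *m A <= E)%MS -> (E *m K *m A <= E *m A)%MS ->
  exists (r l : nat) (U : 'M[R]_(2 * r, N)) (V : 'M[R]_(l, N)) (C B1 : 'M[R]_(2 * r)),
  [/\ (2 * r + l = m)%N,
      [/\ U *m S *m U^T = 1%:M, V *m S *m V^T = 1%:M & U *m S *m V^T = 0],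
      [/\ U *m A = C *m U, U *m B = B1 *m U, C \in unitmx & V *m A = 0],
      (U <= E)%MS & (V <= E)%MS /\
      forall z : 'rV_N, (z <= E)%MS -> z *m A = 0 -> (z <= V)%MS].
Proof.
move=> oE EA EKA.
have [r [l [U [V [C [dimE [oU oV UV] [UA C_unit VA] [UEA EAU] [VE maxV]]]]]]] :=
  skew_split S_sym A_skew oE EA.
have [X UX] := submxP UEA.
have [D UK] : exists D, U *m K = D *m U.
  apply/submxP; apply: submx_trans EAU; apply: submx_trans EKA.
  have -> : U *m K = (- X) *m (E *m K *m A).
    by rewrite UX mulNmx -!mulmxA AK !mulmxN.
  exact: submxMl.
exists r, l, U, V, C, (2^-1 *: (C *m C) + D); split=> //; last first.
  exact: submx_trans UEA EA.
split=> //; rewrite B_def mulmxDr mulmxDl UK -scalemxAr -scalemxAl.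
by rewrite mulmxA UA -!mulmxA UA.
Qed.

Lemma compact_frame m (e : 'rV[R]_N) :
    (m + 1 = N)%N -> e *m S *m e^T = - 1%:M -> e *m A = 0 -> e *m K = 0 ->
  exists (r l : nat) (U : 'M[R]_(2 * r, N)) (V : 'M[R]_(l, N)) (C B1 : 'M[R]_(2 * r)),
  [/\ (2 * r + l = m)%N,
      [/\ U *m S *m U^T = 1%:M, V *m S *m V^T = 1%:M & U *m S *m V^T = 0],
      [/\ U *m A = C *m U, U *m B = B1 *m U & C \in unitmx],
      [/\ V *m A = 0, V *m B = 0 & e *m B = 0] &
      U *m S *m e^T = 0 /\ V *m S *m e^T = 0].
Proof.
move=> dimN qe eA eK.
have qe1 : [<e, e>] = -1 by rewrite /bform qe !mxE.
have qe0 : [<e, e>] < 0 by rewrite qe1 ltrN10.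
have posE (x : 'rV_N) : e *m S *m x^T = 0 -> x != 0 -> 0 < [<x, x>].
  by move=> /bform_eq0 ex; apply: bform_timelike qe0 _; rewrite bformC.
have [|E [oE eE maxE]] := orthonormal_complement S_sym dimN _ posE.
  by rewrite qe -scaleN1r unitmxZ ?unitmx1 // unitrN unitr1.
have stabE M : M *m S = - (S *m M^T) -> e *m M = 0 -> (E *m M <= E)%MS.
  move=> Mskew eM; apply: maxE; apply: trmx_inj.
  rewrite !trmx_mul !trmxK S_sym trmx0 -!mulmxA [M *m _]mulmxA Mskew mulNmx.
  by rewrite -mulmxA -trmx_mul eM trmx0 !(mulmx0, oppr0).
have orthE p (X : 'M[R]_(p, N)) : (X <= E)%MS -> X *m S *m e^T = 0.
  have Ee : E *m S *m e^T = 0.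
    by apply: trmx_inj; rewrite !trmx_mul trmxK S_sym trmx0 mulmxA.
  by move=> /submxP[Y ->]; rewrite -!mulmxA [E *m _]mulmxA Ee mulmx0.
have [|r [l [U [V [C [B1 [dimE oUV [UA UB C_unit VA] UE [VE _]]]]]]]] :=
  skew_split_stable oE (stabE _ A_skew eA).
  exact: submxMr (stabE _ K_skew eK).
(* For a row z of V, z A = 0 gives q (z K) = 0, while z K lies in the positive definite complement
   of e. *)
have VK : V *m K = 0.
  apply/row_matrixP => i; rewrite row_mul row0; set z := row i V.
  have zA : z *m A = 0 by rewrite -row_mul VA row0.
  apply/eqP; apply: contraT => zK.
  have zKe : e *m S *m (z *m K)^T = 0.
    by apply/bform_eq0; rewrite bformC // bform_skew // eK bformC // bform0l oppr0.
  by have := posE _ zKe zK; rewrite bform_KK zA mul0mx bform0l mulr0 subr0 ltxx.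
exists r, l, U, V, C, B1; split=> //; last by split; apply: orthE.
by split=> //; rewrite B_def mulmxDr -scalemxAr mulmxA ?VA ?eA mul0mx scaler0 add0r.
Qed.

Lemma col_bform p (X : 'M[R]_(p, N)) x i : (X *m S *m x^T) i 0 = [<row i X, x>].
Proof. by rewrite /bform -!row_mul [RHS]mxE. Qed.

Lemma parabolic_frame w :
    w *m A != 0 -> [<w *m A, w *m A>] <= 0 ->
  exists (r l : nat) (U : 'M[R]_(2 * r, N)) (V : 'M[R]_(l, N)) (C B1 : 'M[R]_(2 * r))
    (u g f : 'rV_N) (y : 'rV_l),
  let T := col_mx u (col_mx g f) in
  [/\ (2 * r + l + 3 = N)%N,
      [/\ U *m S *m U^T = 1%:M, V *m S *m V^T = 1%:M & U *m S *m V^T = 0],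
      [/\ U *m A = C *m U, U *m B = B1 *m U & C \in unitmx],
      [/\ U *m S *m T^T = 0, V *m S *m T^T = 0 &
        T *m S *m T^T = null_gram R] &
      [/\ y *m y^T = 1%:M,
          V *m A = 0 /\ V *m B = y^T *m u,
          u *m A = 0 /\ u *m B = 0,
          g *m A = u /\ g *m B = 0 &
          f *m A = g /\ f *m B = y *m V + 2^-1 *: u]].
Proof.
move=> wA qw.
have [u [g [f [[qu ug uf] [qg gf qf] [fA gA uA] [uK gK yK] [yu yg yf qy yA]]]]] :=
  null_frame wA qw.
move fK: (f *m K) yK yu yg yf qy yA => y yK yu yg yf qy yA.
pose T := col_mx u (col_mx g f).
have gramT : T *m S *m T^T = null_gram R by apply: null_frame_gram.
have T_unit : T *m S *m T^T \in unitmx.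
  by rewrite gramT; case: (mulmx1_unit (null_gramK R)).
(* The invertible Gram matrix gives T rank 3, so 3 <= N and the subtraction is not truncated. *)
have dimN : (N - 3 + (1 + (1 + 1)) = N)%N.
  rewrite subnK // -[3%N](mxrank_unit T_unit).
  exact: leq_trans (mxrankM_maxr _ _) (rank_leq_row _).
have T0 p (X : 'M[R]_(p, N)) : T *m S *m X^T = 0 <->
    [/\ u *m S *m X^T = 0, g *m S *m X^T = 0 & f *m S *m X^T = 0].
  rewrite !mul_col_mx; split=> [/eqP|[-> -> ->]]; last by rewrite !col_mx0.
  by rewrite !col_mx_eq0 => /and3P[/eqP ? /eqP ? /eqP ?].
have u0 : u != 0.
  by apply: contra_eq_neq uf => ->; rewrite bform0l eq_sym oppr_eq0 oner_eq0.
have posE (x : 'rV_N) : T *m S *m x^T = 0 -> x != 0 -> 0 < [<x, x>].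
  move=> /T0[/bform_eq0 ux _ /bform_eq0 fx]; apply: contraNT; rewrite -leNgt => qx.
  have [||c xc] := lorentzian u0 _ qx; [by rewrite qu | by rewrite bformC |].
  move: fx; rewrite xc bformZr // (bformC S_sym f) uf mulrN1 => /eqP.
  by rewrite oppr_eq0 => /eqP ->; rewrite scale0r.
have [E [oE TE maxE]] := orthonormal_complement S_sym dimN T_unit posE.
have Tsym p (X : 'M[R]_(p, N)) : X *m S *m T^T = 0 <-> T *m S *m X^T = 0.
  split=> h; apply: trmx_inj;
    by rewrite !trmx_mul trmxK S_sym trmx0 mulmxA.
have orthE p (X : 'M[R]_(p, N)) : (X <= E)%MS -> X *m S *m T^T = 0.
  by move=> /submxP[Y ->]; rewrite -!mulmxA [E *m _]mulmxA (iffRL (Tsym _ _)) ?mulmx0.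
have skewE M a : M *m S = - (S *m M^T) ->
    a *m S *m (E *m M)^T = - (a *m M *m S *m E^T).
  by move=> Mskew; rewrite -(mulmxA a M) Mskew mulmxN mulNmx opprK trmx_mul !mulmxA.
have [uE gE _] := iffLR (T0 _ _) TE.
have EA : (E *m A <= E)%MS.
  by apply/maxE/T0; rewrite !skewE // uA gA fA uE gE !mul0mx oppr0.
(* E K leaves E only along u: it is orthogonal to u and g, and its products with f are - Y. Since
   <u, f> = -1, subtracting Y u brings it back into E, and this is invisible after A because u A =
   0. *)
have EKA : (E *m K *m A <= E *m A)%MS.
  pose Y := E *m S *m y^T.
  have -> : E *m K *m A = (E *m K - Y *m u) *m A.
    by rewrite mulmxBl -[Y *m u *m A]mulmxA uA mulmx0 subr0.
  have bformM (a b : 'rV_N) : a *m S *m b^T = ([<a, b>])%:M by apply: mx11_scalar.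
  apply: submxMr; apply/maxE/T0.
  have -> : (E *m K - Y *m u)^T = (E *m K)^T - u^T *m Y^T.
    by rewrite linearB /= [(Y *m u)^T]trmx_mul.
  rewrite !mulmxBr !(skewE _ _ _ K_skew) !mulmxA !bformM.
  rewrite uK gK fK qu (bformC S_sym g) ug (bformC S_sym f) uf !mul0mx !raddf0.
  rewrite !mul0mx !subr0; split=> //.
  by rewrite mul_scalar_mx scaleN1r opprK /Y !trmx_mul trmxK S_sym mulmxA addNr.
have [r [l [U [V [C [B1 [dimE [oU oV UV] [UA UB C_unit VA] UE [VE maxV]]]]]]]] :=
  skew_split_stable oE EA EKA.
have yE : (y <= E)%MS.
  by apply/maxE/T0; split; apply/bform_eq0; rewrite bformC.
have [z yz] := submxP (maxV _ yE yA).
(* For a row x of V, x K is null and orthogonal to u, so x K = c u. Pairing with f gives c = <x, y>,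
   a coordinate of y in the basis V. *)
have VK : V *m K = z^T *m u.
  apply/row_matrixP => i; rewrite !row_mul; set x := row i V.
  have xA : x *m A = 0 by rewrite -row_mul VA row0.
  have [|||c xK] := lorentzian u0 (x := x *m K).
  - by rewrite qu.
  - by rewrite bform_KK xA mul0mx bform0l mulr0 subr0.
  - by rewrite bform_skew // uK bformC // bform0l oppr0.
  rewrite xK; have -> : c = z 0 i.
    have : [<x *m K, f>] = - [<x, y>] by rewrite bform_skew // fK.
    rewrite xK bformZl uf -col_bform yz trmx_mul mulmxA oV mul1mx mxE.
    by rewrite mulrN1 => /oppr_inj.
  by rewrite -tr_col [col i z]mx11_scalar mxE tr_scalar_mx mul_scalar_mx.
have zz : z *m z^T = 1%:M.
  rewrite [LHS]mx11_scalar; congr (_%:M); rewrite -qy /bform yz trmx_mul.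
  by rewrite -!mulmxA [V *m (S *m _)]mulmxA [V *m S *m _]mulmxA oV mul1mx.
have BE p (X : 'M[R]_(p, N)) : X *m B = 2^-1 *: (X *m A *m A) + X *m K.
  by rewrite B_def mulmxDr -scalemxAr mulmxA.
exists r, l, U, V, C, B1, u, g, f, z; split=> //.
- by rewrite dimE.
- by split=> //; apply: orthE.
split=> //; split=> //; rewrite BE ?uA ?gA ?fA ?VA ?mul0mx ?gA ?uA ?scaler0 ?add0r //.
by rewrite fK yz addrC.
Qed.

End Frame.

(** * Quadratic rational curves *)

Lemma sqrD1_gt0 (R : realFieldType) (t : R) : 0 < t ^+ 2 + 1.
Proof. by rewrite ltr_wpDl ?sqr_ge0. Qed.

(** A general filter serves both infinities at once. For |t| >= 1 the first quantity is bounded in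
    absolute value by the second, which is at most e once |t| >= 1 / e. *)
Lemma inv_sqrD1_cvg0 (R : realType) (F : set_system R) (FF : Filter F) :
    (forall M : R, \forall t \near F, M <= `|t|) ->
  (t ^+ 2 + 1)^-1 @[t --> F] --> 0 /\ t * (t ^+ 2 + 1)^-1 @[t --> F] --> 0.
Proof.
move=> Finf.
have bound (e t : R) : 0 < e -> Num.max 1 e^-1 <= `|t| ->
    `|(t ^+ 2 + 1)^-1| <= e /\ `|t * (t ^+ 2 + 1)^-1| <= e.
  move=> e0; rewrite ge_max => /andP[t1 te].
  have q0 := sqrD1_gt0 t.
  have te1 : 1 <= e * `|t| by rewrite -(mulfV (lt0r_neq0 e0)) ler_pM2l.
  have ts : `|t| / (t ^+ 2 + 1) <= e.
    rewrite ler_pdivrMr // -real_normK ?num_real //.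
    have : `|t| * 1 <= `|t| * (e * `|t|) by apply: ler_wpM2l.
    by nra.
  rewrite normrM !(gtr0_norm (x := _^-1)) ?invr_gt0 //; split=> //.
  by apply: le_trans ts; rewrite ler_peMl // invr_ge0 ltW.
split; apply/cvgrPdist_le => e e0; near=> t; rewrite sub0r normrN;
  by have [] := bound e t e0 _; first by near: t; apply: Finf.
Unshelve. all: by end_near. Qed.

Section SimpleCurve.
Variables (R : realType) (N : nat) (A B : 'M[R]_N).

(** Once the value 1 at infinity is split off, a numerator of degree at most one is left over t^2 +
    1. *)
Definition simple_curve (t : R) : 'M[R]_N := 1%:M + (t ^+ 2 + 1)^-1 *: (t *: A + B).

Lemma simple_curveE t :
  simple_curve t = 1%:M + ((t * (t ^+ 2 + 1)^-1) *: A + (t ^+ 2 + 1)^-1 *: B).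
Proof. by rewrite /simple_curve scalerDr scalerA mulrC. Qed.

Lemma simple_curve_at_infty : value_at_infty simple_curve 1%:M.
Proof.
have cvgF (F : set_system R) (FF : Filter F) :
    (forall M : R, \forall t \near F, M <= `|t|) -> simple_curve t @[t --> F] --> (1%:M : 'M[R]_N).
  move=> /(inv_sqrD1_cvg0 FF)[s0 ts0].
  have -> : simple_curve = fun t => 1%:M + ((t * (t ^+ 2 + 1)^-1) *: A + (t ^+ 2 + 1)^-1 *: B).
    by apply/funext => t; exact: simple_curveE.
  have := cvgD (cvg_cst (1%:M : 'M[R]_N)) (cvgD (cvgZr_tmp (a := A) ts0) (cvgZr_tmp (a := B) s0)).
  by rewrite !scale0r !addr0; apply.
split; apply: cvgF => M; near=> t.
- by apply: le_trans (ler_norm t); near: t; apply: nbhs_pinfty_ge; rewrite num_real.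
- rewrite -normrN; apply: le_trans (ler_norm _); rewrite lerNr.
  by near: t; apply: nbhs_ninfty_le; rewrite num_real.
Unshelve. all: by end_near. Qed.

Lemma derive1_simple_curve : derive1 simple_curve 0 = A.
Proof.
rewrite /derive1; apply/cvg_lim => //.
have q1 (h : R) : h ^+ 2 + 1 != 0 by rewrite gt_eqF ?sqrD1_gt0.
have id0 : h @[h --> (0 : R)^'] --> 0 by exact: cvg_within.
have s1 : (h ^+ 2 + 1)^-1 @[h --> (0 : R)^'] --> (0 ^+ 2 + 1 : R)^-1.
  apply: cvgV => //; apply: cvgD; last exact: cvg_cst.
  by rewrite expr2; apply: cvgM.
have s0 : (- h * (h ^+ 2 + 1)^-1) @[h --> (0 : R)^'] --> - 0 * (0 ^+ 2 + 1 : R)^-1.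
  by apply: cvgM => //; apply: cvgN.
have lim : (h ^+ 2 + 1)^-1 *: A + (- h * (h ^+ 2 + 1)^-1) *: B @[h --> (0 : R)^'] -->
    (0 ^+ 2 + 1)^-1 *: A + (- 0 * (0 ^+ 2 + 1 : R)^-1) *: B.
  by apply: cvgD; apply: cvgZr_tmp.
rewrite expr0n add0r invr1 scale1r oppr0 mul0r scale0r addr0 in lim.
apply: cvg_trans lim; apply: near_eq_cvg; near=> h.
have h0 : h != 0 by near: h; exact: nbhs_dnbhs_neq.
apply/matrixP => i j; rewrite !simple_curveE addr0 !mxE expr0n /= mul0r add0r invr1.
by field; rewrite h0 q1.
Unshelve. all: by end_near. Qed.

End SimpleCurve.

Lemma dvdp_big_gcd (F : fieldType) (I : finType) (P : I -> {poly F}) i :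
  \big[@gcdp F/0]_i P i %| P i.
Proof.
have : i \in index_enum I by exact: mem_index_enum.
elim: (index_enum I) => // a s IHs; rewrite big_cons inE => /predU1P[<-|/IHs].
  exact: dvdp_gcdl.
exact/dvdp_trans/dvdp_gcdr.
Qed.

Lemma size_sqXD1 (R : realType) : size ('X^2 + 1 : {poly R}) = 3%N.
Proof. by rewrite size_addl ?size_polyXn ?size_poly1. Qed.

Lemma root_sqXD1 (R : realType) (t : R) : ~~ root ('X^2 + 1) t.
Proof. by rewrite /root !hornerE gt_eqF ?sqrD1_gt0. Qed.

Lemma roots_complex_sqXD1 (R : realType) :
  [set z | root (map_poly (real_complex R) ('X^2 + 1)) z] = [set 'i%C; - 'i%C].
Proof.
apply/seteqP; split=> z /=.
  rewrite /root rmorphD /= map_polyXn rmorph1 !hornerE /=.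
  have -> : z ^+ 2 + 1 = (z - 'i%C) * (z + 'i%C).
    by rewrite -subr_sqr sqr_i opprK.
  by rewrite mulf_eq0 subr_eq0 addr_eq0 => /orP[] /eqP; [left | right].
rewrite /root rmorphD /= map_polyXn rmorph1 !hornerE /=.
by case=> ->; rewrite ?sqrrN sqr_i addNr.
Qed.

(** The real and imaginary parts of p(i) = 0 say that the outer coefficients agree and that the
    middle one vanishes. *)
Lemma quadratic_den (R : realType) (p : {poly R}) :
    size p = 3%N -> root (map_poly (real_complex R) p) 'i%C ->
  exists2 c, c != 0 & p = c *: ('X^2 + 1).
Proof.
move=> sp; rewrite /root horner_coef size_map_poly sp !big_ord_recl big_ord0 /=.
rewrite !coef_map /= expr0 mulr1 expr1 sqr_i addr0 => /eqP h.
have [p02 p1] : p`_0 - p`_2 = 0 /\ p`_1 = 0.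
  by case: h; rewrite /bump /= => h1 h2; split; lra.
have l2 : p`_2 = lead_coef p by rewrite lead_coefE sp.
exists p`_2; first by rewrite l2 lead_coef_eq0 -size_poly_eq0 sp.
apply/polyP => i; rewrite coefZ coefD coefXn coef1.
case: i => [|[|[|i]]] /=; rewrite ?mulr0 ?addr0 ?add0r ?mulr1 //.
- by move/eqP: p02; rewrite subr_eq0 => /eqP.
- by rewrite p1 mulr0.
- by rewrite nth_default ?sp // mulr0.
Qed.

Lemma small_at_infty_size (R : realType) (p : {poly R}) :
  p.[t] / (t ^+ 2 + 1) @[t --> +oo] --> 0 -> (size p <= 2)%N.
Proof.
wlog lp : p / 0 <= lead_coef p.
  move=> H; have [|lp plim] := leP 0 (lead_coef p); first exact: H.
  rewrite -size_polyN; apply: H; first by rewrite lead_coefN oppr_ge0 ltW.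
  under eq_fun do rewrite hornerN mulNr.
  by rewrite -oppr0; apply: cvgN.
move=> plim; rewrite leqNgt; apply/negP => sp.
have lp0 : 0 < lead_coef p.
  by rewrite lt_def lp andbT lead_coef_eq0 -size_poly_gt0 (ltn_trans _ sp).
(* Halving the leading coefficient keeps that of d positive even when p has degree exactly 2. So p
   exceeds e (t^2 + 1) for large t, against the limit 0. *)
pose e := lead_coef p / 2; have e0 : 0 < e by rewrite divr_gt0.
pose d := p - e *: ('X^2 + 1).
have ld : 0 < lead_coef d.
  rewrite /d; move: sp; rewrite leq_eqVlt => /predU1P[sp|sp]; last first.
    by rewrite lead_coefDl // size_polyN size_scale ?gt_eqF // size_sqXD1.
  have d2 : d`_2 = e.
    rewrite coefB coefZ coefD coefXn coef1 /= addr0 mulr1.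
    have -> : p`_2 = lead_coef p by rewrite lead_coefE -sp.
    by rewrite /e; lra.
  suff -> : lead_coef d = e by [].
  rewrite lead_coefE -d2; congr (_`_ _).
  have : (size d <= 3)%N.
    rewrite (leq_trans (size_polyD _ _)) // size_polyN size_scale ?gt_eqF //.
    by rewrite size_sqXD1 -sp.
  case sd : (size d) => [|[|[|[|//]]]] // _;
  by move: d2; rewrite nth_default ?sd // => /esym; move/eqP; rewrite gt_eqF.
have [M HM] := poly_pinfty_gt_lc ld.
have near_e : \forall t \near (+oo : set_system R), `|p.[t] / (t ^+ 2 + 1)| < e.
  by move/cvgr0Pnorm_lt : plim; apply.
have near_M : \forall t \near (+oo : set_system R), M <= t.
  by apply: nbhs_pinfty_ge; rewrite num_real.
have [t [te /HM]] := filter_ex (filterI near_e near_M).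
move: te; rewrite /d !hornerE => /(le_lt_trans (ler_norm _)).
by rewrite ltr_pdivrMr ?sqrD1_gt0 // => h1 h2; lra.
Qed.

Lemma quadratic_curveP (R : realType) N (G : set 'M[R]_N) (gamma : rational_curve G) :
    quadratic_with_poles_i gamma -> value_at_infty gamma 1%:M ->
  exists A B, forall t, gamma t = simple_curve A B t.
Proof.
move=> [deg poles] [lim _].
have sden : size (curve_den gamma) = 3%N.
  by move: deg; rewrite /curve_degree; case: (size _) => // k /= ->.
have iroot : root (map_poly (real_complex R) (curve_den gamma)) 'i%C.
  have : curve_poles gamma 'i%C by rewrite poles; left.
  by [].
have [c c0 denE] := quadratic_den sden iroot.
(* D is the numerator minus the limit times the denominator. Its quotient by t^2 + 1 tends to 0, so
   D is affine in t; its coefficients divided by c are the entries of A and B. *)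
pose D i j := curve_num gamma i j - ((1%:M : 'M[R]_N) i j * c) *: ('X^2 + 1).
have entry t i j : gamma t i j = (1%:M : 'M[R]_N) i j + (D i j).[t] / (t ^+ 2 + 1) / c.
  rewrite /curve_fun denE !mxE /= /D !hornerE.
  have q0 : t ^+ 2 + 1 != 0 by rewrite gt_eqF ?sqrD1_gt0.
  by rewrite mxE; field; rewrite q0 c0.
have sD i j : (size (D i j) <= 2)%N.
  apply: small_at_infty_size.
  have lim_ij : gamma t i j @[t --> +oo] --> (1%:M : 'M[R]_N) i j.
    exact: (cvg_comp _ _ lim (@coord_continuous _ _ _ i j (1%:M : 'M[R]_N))).
  have -> : (fun t => (D i j).[t] / (t ^+ 2 + 1)) =
      fun t => (gamma t i j - (1%:M : 'M[R]_N) i j) * c.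
    by apply/funext => t; rewrite entry addrAC subrr add0r mulfVK.
  rewrite -[X in _ --> X](mul0r c) -(subrr ((1%:M : 'M[R]_N) i j)).
  by apply: cvgM; [apply: cvgB => //; apply: cvg_cst | apply: cvg_cst].
exists (\matrix_(i, j) ((D i j)`_1 / c)), (\matrix_(i, j) ((D i j)`_0 / c)) => t.
apply/matrixP => i j; rewrite entry !mxE; congr (_ + _).
rewrite (horner_coef_wide _ (sD i j)) !big_ord_recl big_ord0 /= expr0 expr1.
have q0 : t ^+ 2 + 1 != 0 by rewrite gt_eqF ?sqrD1_gt0.
by field; rewrite q0 c0.
Qed.

(** Coprimality comes from A being nonzero: as t^2 + 1 has no real root, a nonconstant common
    divisor is t^2 + 1 itself up to a unit, and it can divide every t A_ij + B_ij only if A = 0. *)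
Lemma simple_rational_curve (R : realType) N (G : set 'M[R]_N) (A B : 'M[R]_N) :
    A != 0 -> G 1%:M -> (forall t, G (simple_curve A B t)) ->
  exists2 gamma : rational_curve G,
    quadratic_with_poles_i gamma & forall t, gamma t = simple_curve A B t.
Proof.
move=> A0 G1 GAB.
pose M : 'M[{poly R}]_N := \matrix_(i, j)
  ((1%:M : 'M[R]_N) i j *: ('X^2 + 1) + A i j *: 'X + (B i j)%:P).
have ME t : (('X^2 + 1 : {poly R}).[t])^-1 *: map_mx (horner^~ t) M = simple_curve A B t.
  apply/matrixP => i j; rewrite [LHS]mxE !hornerE 4!mxE /= !hornerE.
  rewrite !mxE.
  have q0 : t ^+ 2 + 1 != 0 by rewrite gt_eqF ?sqrD1_gt0.
  by field.
have cop : coprimep ('X^2 + 1) (\big[@gcdp R/0]_i \big[@gcdp R/0]_j M i j).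
  set g := \big[_/_]_i _; rewrite /coprimep; set h := gcdp _ g.
  have hq : h %| 'X^2 + 1 by apply: dvdp_gcdl.
  have q0 : 'X^2 + 1 != 0 :> {poly R} by rewrite -size_poly_eq0 size_sqXD1.
  have hM i j : h %| M i j.
    apply: dvdp_trans (dvdp_gcdr _ _) (dvdp_trans (dvdp_big_gcd _ i) _).
    exact: (dvdp_big_gcd (fun j => M i j) j).
  have h0 : h != 0 by rewrite gcdp_eq0 (negPf q0).
  have := dvdp_leq q0 hq; rewrite size_sqXD1.
  case sh : (size h) => [|[|[|[|//]]]] // _.
  - by move/eqP: sh; rewrite size_poly_eq0 (negPf h0).
  - have [x hx] := poly2_root sh; have := root_sqXD1 x.
    by rewrite -dvdp_XsubCl (dvdp_trans _ hq) // dvdp_XsubCl.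
  case/negP: A0; apply/eqP/matrixP => i j; rewrite [RHS]mxE.
  have hq_eqp : h %= 'X^2 + 1 by rewrite -(dvdp_size_eqp hq) sh size_sqXD1.
  have : 'X^2 + 1 %| A i j *: 'X + (B i j)%:P.
    have := hM i j; rewrite (eqp_dvdl _ hq_eqp) mxE -addrA dvdp_addr //.
    by rewrite -mul_polyC dvdp_mull.
  have sAB : (size (A i j *: 'X + (B i j)%:P)%R <= 2)%N.
    rewrite (leq_trans (size_polyD _ _)) // geq_max (leq_trans (size_scale_leq _ _)).
      by rewrite (leq_trans (size_polyC_leq1 _)).
    by rewrite size_polyX.
  have [/(congr1 (coefp 1%N))|nz /(dvdp_leq nz)] := eqVneq (A i j *: 'X + (B i j)%:P) 0.
    by rewrite /= coefD coefZ coefX coefC coef0 /= mulr1 addr0.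
  by rewrite size_sqXD1 leqNgt ltnS sAB.
have at_infty : exists2 L, G L & value_at_infty
    (fun t => (('X^2 + 1 : {poly R}).[t])^-1 *: map_mx (horner^~ t) M) L.
  exists 1%:M => //.
  by rewrite (funext ME : _ = simple_curve A B); apply: simple_curve_at_infty.
have inG t : G ((('X^2 + 1 : {poly R}).[t])^-1 *: map_mx (horner^~ t) M) by rewrite ME.
exists (@RationalCurve R N G M _ (@root_sqXD1 R) cop inG at_infty).
  split; first by rewrite /curve_degree /= size_sqXD1.
  by rewrite /curve_poles /= roots_complex_sqXD1.
by [].
Qed.

(** * The equations that the isometry condition imposes on A and B *)

Lemma cubic_mx_eq0 (R : realFieldType) m n (X3 X2 X1 X0 : 'M[R]_(m, n)) :
    (forall t : R, t ^+ 3 *: X3 + t ^+ 2 *: X2 + t *: X1 + X0 = 0) ->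
  [/\ X3 = 0, X2 = 0, X1 = 0 & X0 = 0].
Proof.
move=> X0E; have H i j t : t ^+ 3 * X3 i j + t ^+ 2 * X2 i j + t * X1 i j + X0 i j = 0.
  by have /matrixP/(_ i j) := X0E t; rewrite !mxE.
(* The values at 0, 1, -1 and 2 determine a cubic. *)
by split; apply/matrixP => i j; rewrite [RHS]mxE;
  have := H i j 0; have := H i j 1; have := H i j (-1); have := H i j 2; lra.
Qed.

Lemma simple_curve_isometry (R : realType) N (S A B : 'M[R]_N) :
    S^T = S -> S \in unitmx ->
    (forall t, simple_curve A B t *m S *m (simple_curve A B t)^T = S) ->
  let K := B - 2^-1 *: (A *m A) in
  [/\ A *m S = - (S *m A^T), K *m S = - (S *m K^T), A *m K = - (K *m A) &
      K *m K = 4^-1 *: (A *m A *m (A *m A)) + A *m A].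
Proof.
move=> S_sym S_unit iso K.
have cubic t : t ^+ 3 *: (A *m S + S *m A^T)
    + t ^+ 2 *: (B *m S + S *m B^T + A *m S *m A^T)
    + t *: (A *m S + S *m A^T + (A *m S *m B^T + B *m S *m A^T))
    + (B *m S + S *m B^T + B *m S *m B^T) = 0.
  have q0 : t ^+ 2 + 1 != 0 by rewrite gt_eqF ?sqrD1_gt0.
  have := iso t; rewrite /simple_curve.
  have -> : (1%:M + (t ^+ 2 + 1)^-1 *: (t *: A + B))^T
      = 1%:M + (t ^+ 2 + 1)^-1 *: (t *: A^T + B^T).
    by apply/matrixP => i j; rewrite !mxE eq_sym.
  rewrite !(mulmxDl, mulmxDr) -!(scalemxAl, scalemxAr) !(mulmxDl, mulmxDr).
  rewrite -!(scalemxAl, scalemxAr) !(mulmx1, mul1mx).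
  move: (A *m S *m A^T) (A *m S *m B^T) (B *m S *m A^T) (B *m S *m B^T).
  move: (A *m S) (B *m S) (S *m A^T) (S *m B^T) => Y1 Y2 Y3 Y4 Y5 Y6 Y7 Y8 /matrixP h.
  apply/matrixP => i j; move: (h i j); rewrite !mxE.
  move/(congr1 (fun z => (t ^+ 2 + 1) ^+ 2 * (z - S i j))).
  by rewrite subrr mulr0 => <-; field.
(* In turn, the coefficients of t^3, t^2, t and 1 yield the skewness of A, a formula for S B^T, the
   relation A B + B A = A^3, and B^2 = A^2 + B A^2. *)
have [h3 h2 h1 h0] := cubic_mx_eq0 cubic.
have SA : S *m A^T = - (A *m S) by apply/eqP; rewrite -addr_eq0 addrC h3.
have ASA : A *m S *m A^T = - (A *m A *m S) by rewrite -mulmxA SA mulmxN mulmxA.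
have SB : S *m B^T = A *m A *m S - B *m S.
  apply/eqP; rewrite -subr_eq0 opprB addrA (addrC (S *m B^T)); apply/eqP.
  by rewrite -[RHS]h2 ASA.
have AB : A *m B + B *m A = A *m A *m A.
  apply: (can_inj (mulmxK S_unit)); move: h1.
  rewrite h3 add0r -[A *m S *m B^T]mulmxA SB -[B *m S *m A^T]mulmxA SA.
  rewrite mulmxBr mulmxN !mulmxDl !mulmxA => h.
  by apply/eqP; rewrite eq_sym -subr_eq0 -h opprD addrA.
have BB : B *m B = A *m A + B *m A *m A.
  apply: (can_inj (mulmxK S_unit)); move: h0.
  rewrite -[B *m S *m B^T]mulmxA SB addrCA subrr addr0 mulmxBr !mulmxDl !mulmxA => h.
  by apply/eqP; rewrite eq_sym -subr_eq0 -h addrA.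
(* By A B + B A = A^3, commuting B past A twice restores the sign and the cubic terms cancel. *)
have AAB : A *m A *m B = B *m A *m A.
  have AB' : A *m B = A *m A *m A - B *m A by rewrite -AB addrK.
  rewrite -mulmxA AB' mulmxBr !mulmxA AB' mulmxBl opprB.
  by rewrite addrCA subrr addr0.
split.
- by rewrite SA opprK.
- have -> : K^T = B^T - 2^-1 *: (A *m A)^T by rewrite linearB linearZ.
  rewrite mulmxBr -scalemxAr trmx_mul mulmxA SA mulNmx ASA opprK SB mulmxBl -scalemxAl.
  move: (A *m A *m S) (B *m S) => P Q.
  by apply/matrixP => i j; rewrite !mxE; lra.
- rewrite mulmxBr mulmxBl -scalemxAr -scalemxAl !mulmxA; move: AB.
  move: (A *m A *m A) (A *m B) (B *m A) => P Q1 Q2 /matrixP h.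
  by apply/matrixP => i j; move: (h i j); rewrite !mxE; lra.
- rewrite mulmxBr !mulmxBl -!scalemxAr -!scalemxAl !mulmxA AAB BB .
  move: (A *m A) (B *m A *m A) (A *m A *m A *m A) => P Q1 Q2.
  by apply/matrixP => i j; rewrite !mxE; lra.
Qed.

(** * The standard Lorentz form *)

Section LorentzForm.
Variables (R : realType) (n : nat).
Local Notation J := (lorentz_form R n).

Lemma lorentz_form_sym : J^T = J.
Proof. by rewrite /lorentz_form tr_block_mx !trmx0 raddfN /= !trmx1. Qed.

Lemma lorentz_form_unit : J \in unitmx.
Proof.
suff JJ : J *m J = 1%:M by case: (mulmx1_unit JJ).
rewrite /lorentz_form mulmx_block !(mulmx0, mul0mx, mulmx1, addr0, add0r).
by rewrite mulmxN mulmx1 opprK -scalar_mx_block.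
Qed.

Lemma bform_row_mx (a c : 'rV[R]_n) (b d : 'rV_1) :
  bform J (row_mx a b) (row_mx c d) = (a *m c^T) 0 0 - b 0 0 * d 0 0.
Proof.
rewrite /bform /lorentz_form mul_row_block !mulmx0 addr0 add0r mulmx1 mulmxN mulmx1.
by rewrite tr_row_mx mul_row_col mulNmx mxE; congr (_ + _); rewrite mxE [d]mx11_scalar
  tr_scalar_mx mul_mx_scalar !mxE mulrC.
Qed.

Lemma lorentz_form_timelike : exists v : 'rV_(n + 1), bform J v v < 0.
Proof.
exists (row_mx 0 1%:M); rewrite bform_row_mx mul0mx !mxE mulr1 sub0r.
by rewrite oppr_lt0 ltr01.
Qed.

(* Subtracting from x the multiple of v with the same last coordinate leaves a
   vector on which the bform is both nonpositive and positive definite. *)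
Lemma lorentz_form_lorentzian (v x : 'rV_(n + 1)) :
  v != 0 -> bform J v v <= 0 -> bform J x x <= 0 -> bform J x v = 0 ->
  exists c, x = c *: v.
Proof.
rewrite -[v]hsubmxK -[x]hsubmxK.
move: (lsubmx v) (rsubmx v) (lsubmx x) (rsubmx x) => v1 v0 x1 x0 vN0 qv qx xv.
have v00 : v0 0 0 != 0.
  apply: contraNneq vN0 => v00; move: qv; rewrite bform_row_mx v00 mulr0 subr0.
  have [->|/dot_gt0 v1_gt0 /(lt_le_trans v1_gt0)] := eqVneq v1 0; last by rewrite ltxx.
  by move=> _; rewrite [v0]mx11_scalar v00 raddf0 row_mx0.
pose c := x0 0 0 / v0 0 0; exists c.
set X := row_mx x1 x0 in qx xv *; set V := row_mx v1 v0 in qv xv *.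
have zE : X - c *: V = row_mx (x1 - c *: v1) 0.
  rewrite /X /V scale_row_mx opp_row_mx add_row_mx; congr row_mx.
  by apply/rowP => k; rewrite (ord1 k) !mxE /c divfK // subrr.
have qz : bform J (X - c *: V) (X - c *: V) <= 0.
  have Jsym := lorentz_form_sym.
  rewrite -scaleNr bformDl !bformDr // !bformZl !bformZr // (bformC Jsym V) xv.
  by have := mulr_ge0_le0 (sqr_ge0 c) qv; rewrite expr2; lra.
have z0 : x1 - c *: v1 = 0.
  apply/eqP; apply: contraLR qz => /dot_gt0 z0; rewrite -ltNge zE bform_row_mx.
  by rewrite !mxE mulr0 subr0 in z0 *.
by apply/eqP; rewrite -subr_eq0 zE z0 row_mx0.
Qed.

End LorentzForm.

(** * Dimension casts of block matrices *)

Lemma mulmx_castlr (F : pzSemiRingType) m m' p (E : m = m') (X : 'M[F]_m) (Y : 'M[F]_(m, p)) :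
  castmx (E, E) X *m castmx (E, erefl) Y = castmx (E, erefl) (X *m Y).
Proof. by case: m' / E. Qed.

Lemma mulmx_castl (F : pzSemiRingType) m m' p q (E : m = m') (X : 'M[F]_(m, p)) (Y : 'M[F]_(p, q)) :
  castmx (E, erefl) X *m Y = castmx (E, erefl) (X *m Y).
Proof. by case: m' / E. Qed.

Lemma castmx_gram (F : pzSemiRingType) m m' p (E : m = m') (S : 'M[F]_p) (X : 'M[F]_(m, p)) :
  castmx (E, erefl) X *m S *m (castmx (E, erefl) X)^T = castmx (E, E) (X *m S *m X^T).
Proof. by case: m' / E. Qed.

Lemma castmx1 (F : pzSemiRingType) m m' (E : m = m') : castmx (E, E) (1%:M : 'M[F]_m) = 1%:M.
Proof. by case: m' / E. Qed.

Lemma mulmx_castmx (F : pzSemiRingType) m m' (E : m = m') (X Y : 'M[F]_m) :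
  castmx (E, E) X *m castmx (E, E) Y = castmx (E, E) (X *m Y).
Proof. by case: m' / E. Qed.

Lemma castmx_tr (F : pzSemiRingType) m m' (E : m = m') (X : 'M[F]_m) :
  (castmx (E, E) X)^T = castmx (E, E) X^T.
Proof. by case: m' / E. Qed.

Lemma col_mx_cast (F : Type) m1 m2 m3 m m' p (E12 : (m1 + m2 = m)%N)
    (E : (m1 + (m2 + m3) = m')%N) (E' : (m + m3 = m')%N)
    (A1 : 'M[F]_(m1, p)) (A2 : 'M[F]_(m2, p)) (A3 : 'M[F]_(m3, p)) :
  castmx (E, erefl) (col_mx A1 (col_mx A2 A3)) =
  castmx (E', erefl) (col_mx (castmx (E12, erefl) (col_mx A1 A2)) A3).
Proof.
case: m / E12 in E' *; case: m' / E' in E *; rewrite !castmx_id col_mxA castmx_comp.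
by rewrite (eq_irrelevance (etrans _ _) erefl) castmx_id.
Qed.

Lemma col_mx_castr (F : Type) m1 m2 m2' m' p (D : m2 = m2')
    (E : (m1 + m2 = m')%N) (E' : (m1 + m2' = m')%N)
    (X : 'M[F]_(m1, p)) (Y : 'M[F]_(m2, p)) :
  castmx (E, erefl) (col_mx X Y) = castmx (E', erefl) (col_mx X (castmx (D, erefl) Y)).
Proof. by case: m2' / D in E' *; rewrite (eq_irrelevance E E') castmx_id. Qed.

Lemma lorentz_form_cast (R : realType) n m (E : (m + 3 = n + 1)%N) :
  castmx (E, E) (block_mx 1%:M 0 0 (lorentz_form R 2)) = lorentz_form R n.
Proof.
rewrite !lorentz_formE; apply/matrixP => i j; rewrite castmxE [RHS]mxE.
have lta (a : 'I_m) : (a < n)%N by have := ltn_ord a; lia.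
have ltb (b : 'I_3) : (m + b < n)%N = (b < 2)%N by lia.
rewrite -val_eqE.
case: (split_ordP (cast_ord (esym E) i)) => a ia; rewrite ia;
  move: ia => /(congr1 val) /= ->;
case: (split_ordP (cast_ord (esym E) j)) => b jb; rewrite jb;
  move: jb => /(congr1 val) /= ->.
- by rewrite block_mxEul lta mxE.
- by rewrite block_mxEur mxE lta ltn_eqF // ltn_addr.
- by rewrite block_mxEdl mxE gtn_eqF // ltn_addr.
- by rewrite block_mxEdr mxE ltb eqn_add2l.
Qed.

(** * Curves on the orthogonal group and Lorentz bases *)

Lemma skew_orthogonal_curve (R : realType) r (C B : 'M[R]_(2 * r)) :
    C \in unitmx -> (forall t, simple_curve C B t *m (simple_curve C B t)^T = 1%:M) ->
  exists beta : rational_curve (@orthogonal_group R (2 * r)),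
    [/\ ((0 < r)%N -> quadratic_with_poles_i beta),
        \rank (derive1 beta 0) = (2 * r)%N & forall t, beta t = simple_curve C B t].
Proof.
move=> C_unit orth.
suff [beta quad betaE] : exists2 beta : rational_curve (@orthogonal_group R (2 * r)),
    (0 < r)%N -> quadratic_with_poles_i beta & forall t, beta t = simple_curve C B t.
  exists beta; split=> //.
  by rewrite (funext betaE : curve_fun beta = _) derive1_simple_curve mxrank_unit.
have orthG t : orthogonal_group (simple_curve C B t).
  by split; [case: (mulmx1_unit (orth t)) | exact: orth].
(* For r > 0 an invertible C is nonzero, which makes the fraction reduced. For r = 0 all matrices
   coincide, and the constant denominator 1 provides the empty block. *)
have [r0|r0] := posnP r; last first.
  have C0 : C != 0 by rewrite -mxrank_eq0 mxrank_unit // muln_eq0 -lt0n.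
  have [|beta quad betaE] := simple_rational_curve C0 _ orthG; last by exists beta.
  by split; [exact: unitmx1 | rewrite trmx1 mulmx1].
have trivial_mx (X Y : 'M[R]_(2 * r)) : X = Y.
  by apply/matrixP => -[i lti]; exfalso; move: lti; rewrite r0.
pose gamma t : 'M[R]_(2 * r) := (1 : {poly R}).[t]^-1 *: map_mx (horner^~ t) 0.
have gammaE t : gamma t = simple_curve C B t by apply: trivial_mx.
have noroot (t : R) : ~~ root 1 t by rewrite root1.
have inG t : orthogonal_group (gamma t) by rewrite gammaE.
have at_infty : exists2 L, orthogonal_group L & value_at_infty gamma L.
  exists (simple_curve C B 0) => //; rewrite (funext gammaE : gamma = _).
  by rewrite (trivial_mx (simple_curve C B 0) 1%:M); apply: simple_curve_at_infty.
by exists (RationalCurve noroot (coprime1p _) inG at_infty); rewrite ?r0.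
Qed.

Lemma mulmx_simple_curve (R : realType) N (A B : 'M[R]_N) p (X : 'M[R]_(p, N)) t :
  X *m simple_curve A B t = X + (t ^+ 2 + 1)^-1 *: (t *: (X *m A) + X *m B).
Proof. by rewrite mulmxDr mulmx1 -scalemxAr mulmxDr -scalemxAr. Qed.

Lemma simple_curve_mulmx (R : realType) N (A B : 'M[R]_N) p (X : 'M[R]_(N, p)) t :
  simple_curve A B t *m X = X + (t ^+ 2 + 1)^-1 *: (t *: (A *m X) + B *m X).
Proof. by rewrite mulmxDl mul1mx -scalemxAl mulmxDl -scalemxAl. Qed.

(** The rows of M are a Lorentz-orthonormal basis adapted to the curve; the conjugating matrix P
    will be the inverse of M. *)
Lemma lorentz_group_inv (R : realType) n (M : 'M[R]_(n + 1)) :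
  M *m lorentz_form R n *m M^T = lorentz_form R n ->
  M \in unitmx /\ lorentz_group (invmx M).
Proof.
move=> MJ; have Junit := lorentz_form_unit R n.
have M_unit : M \in unitmx.
  have : M *m (lorentz_form R n *m M^T *m invmx (lorentz_form R n)) = 1%:M.
    by rewrite !mulmxA MJ mulmxV.
  by case/mulmx1_unit.
split=> //; split; first by rewrite unitmx_inv.
rewrite -{1}MJ !mulmxA mulVmx // mul1mx -mulmxA -trmx_mul mulVmx //.
by rewrite trmx1 mulmx1.
Qed.

(** * Normal forms *)

Section NormalForms.
Variables (R : realType) (n : nat) (A B : 'M[R]_(n + 1)).
Local Notation J := (lorentz_form R n).
Local Notation alpha := (simple_curve A B).
Hypothesis alpha_iso : forall t, alpha t *m J *m (alpha t)^T = J.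

(** The block [beta] is the matrix of the curve on the span of U. It is orthogonal because the curve
    preserves the form and U is orthonormal; its derivative at 0 is the invertible C. *)
Lemma diagonal_curve r (U : 'M[R]_(2 * r, n + 1)) (C D : 'M[R]_(2 * r)) :
    U *m J *m U^T = 1%:M -> U *m A = C *m U -> U *m B = D *m U -> C \in unitmx ->
  exists beta : rational_curve (@orthogonal_group R (2 * r)),
    [/\ ((0 < r)%N -> quadratic_with_poles_i beta),
        \rank (derive1 beta 0) = (2 * r)%N & forall t, beta t *m U = U *m alpha t].
Proof.
move=> oU UA UB C_unit.
have CU t : simple_curve C D t *m U = U *m alpha t.
  by rewrite mulmx_simple_curve simple_curve_mulmx UA UB.
have [t|beta [quad rk betaE]] := skew_orthogonal_curve (B := D) C_unit.
  set b := simple_curve C D t.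
  have -> : b *m b^T = (b *m U) *m J *m (b *m U)^T.
    by rewrite trmx_mul !mulmxA -(mulmxA b U) -(mulmxA b (U *m J)) oU mulmx1.
  by rewrite CU trmx_mul -!mulmxA (mulmxA (alpha t)) (mulmxA _ (alpha t)^T) alpha_iso mulmxA.
by exists beta; split=> // t; rewrite betaE.
Qed.

Lemma compact_normal_form r l (U : 'M[R]_(2 * r, n + 1)) (V : 'M[R]_(l, n + 1))
    (e : 'rV[R]_(n + 1)) (C D : 'M[R]_(2 * r)) :
    (2 * r + l = n)%N ->
    [/\ U *m J *m U^T = 1%:M, V *m J *m V^T = 1%:M & U *m J *m V^T = 0] ->
    [/\ U *m A = C *m U, U *m B = D *m U & C \in unitmx] ->
    [/\ V *m A = 0, V *m B = 0 & e *m B = 0] ->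
    e *m J *m e^T = - 1%:M -> e *m A = 0 ->
    U *m J *m e^T = 0 /\ V *m J *m e^T = 0 ->
  exists (P : 'M[R]_(n + 1)) (r : nat) (hr : (2 * r <= n)%N)
      (beta : rational_curve (@orthogonal_group R (2 * r))),
     [/\ lorentz_group P,
         ((0 < r)%N -> quadratic_with_poles_i beta),
         \rank (derive1 beta 0) = (2 * r)%N
       & forall t : R,
           alpha t = P *m compact_block hr (beta t) *m invmx P].
Proof.
move=> dimn [oU oV UV] [UA UB C_unit] [VA VB eB] qe eA [Ue Ve].
have [beta [quad rk betaU]] := diagonal_curve oU UA UB C_unit.
have hr : (2 * r <= n)%N by lia.
have E : (2 * r + (l + 1) = n + 1)%N by lia.
pose M := castmx (E, erefl) (col_mx U (col_mx V e)).
have sym p q (X : 'M[R]_(p, n + 1)) (Y : 'M[R]_(q, n + 1)) :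
    X *m J *m Y^T = 0 -> Y *m J *m X^T = 0.
  by move=> h; apply: trmx_inj; rewrite !trmx_mul trmxK lorentz_form_sym mulmxA h trmx0.
have MJ : M *m J *m M^T = J.
  rewrite /M (col_mx_cast dimn E erefl) castmx_id tr_col_mx mul_col_mx mul_col_row.
  rewrite castmx_gram tr_col_mx mul_col_mx mul_col_row oU oV UV (sym _ _ _ _ UV).
  rewrite -scalar_mx_block castmx1 qe.
  have We : castmx (dimn, erefl) (col_mx U V) *m J *m e^T = 0.
    by rewrite !mulmx_castl !mul_col_mx Ue Ve col_mx0 castmx_const.
  by rewrite We (sym _ _ _ _ We).
have [M_unit PG] := lorentz_group_inv MJ.
exists (invmx M), r, hr, beta; split=> // t.
(* After multiplication by M it remains to compare M alpha with the block matrix times M, one row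
   block at a time. *)
rewrite invmxK -mulmxA; apply: (can_inj (mulKmx M_unit)); rewrite mulKVmx //.
have Dim : (l + 1 = n + 1 - 2 * r)%N by lia.
have -> : M = castmx (dim_compact hr, erefl) (col_mx U (castmx (Dim, erefl) (col_mx V e))).
  exact: col_mx_castr.
rewrite /compact_block mulmx_castlr mulmx_castl; congr castmx.
rewrite mul_block_col !mul0mx addr0 add0r mul1mx mul_col_mx betaU mulmx_castl.
rewrite mul_col_mx !mulmx_simple_curve VA VB eA eB.
by rewrite !(scaler0, addr0).
Qed.

Lemma parabolic_normal_form r l (U : 'M[R]_(2 * r, n + 1)) (V : 'M[R]_(l, n + 1))
    (C D : 'M[R]_(2 * r)) (u g f : 'rV[R]_(n + 1)) (y : 'rV[R]_l) :
    let T := col_mx u (col_mx g f) in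
    (2 * r + l + 3 = n + 1)%N ->
    [/\ U *m J *m U^T = 1%:M, V *m J *m V^T = 1%:M & U *m J *m V^T = 0] ->
    [/\ U *m A = C *m U, U *m B = D *m U & C \in unitmx] ->
    [/\ U *m J *m T^T = 0, V *m J *m T^T = 0 & T *m J *m T^T = null_gram R] ->
    [/\ y *m y^T = 1%:M,
          V *m A = 0 /\ V *m B = y^T *m u,
          u *m A = 0 /\ u *m B = 0,
          g *m A = u /\ g *m B = 0 &
          f *m A = g /\ f *m B = y *m V + 2^-1 *: u] ->
  exists (P : 'M[R]_(n + 1)) (r : nat) (hr : (2 * r + 3 <= n)%N)
      (y : 'cV[R]_(n - 2 * r - 2))
      (beta : rational_curve (@orthogonal_group R (2 * r))),
     [/\ lorentz_group P,
         unit_sphere y,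
         ((0 < r)%N -> quadratic_with_poles_i beta),
         \rank (derive1 beta 0) = (2 * r)%N
       & forall t : R,
           alpha t = P *m Q3_tr_block R hr *m parabolic_block hr (beta t) y t
                       *m Q3_block R hr *m invmx P].
Proof.
move=> T dimn [oU oV UV] [UA UB C_unit] [UT VT gramT].
move=> [yy [VA VB] [uA uB] [gA gB] [fA fB]].
have [beta [quad rk betaU]] := diagonal_curve oU UA UB C_unit.
(* A unit vector y needs at least one coordinate, so l >= 1. This is what gives 2 r + 3 <= n. *)
have l0 : (0 < l)%N.
  rewrite lt0n; apply: contraTneq isT => l0; exfalso.
  have /matrixP/(_ 0 0) := yy; rewrite !mxE big1 => [/esym/eqP|[i lti]].
    by rewrite oner_eq0.
  by exfalso; move: lti; rewrite l0.
have hr : (2 * r + 3 <= n)%N by lia.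
have lE : l = (n - 2 * r - 2)%N by lia.
subst l.
have sym p q (X : 'M[R]_(p, n + 1)) (Y : 'M[R]_(q, n + 1)) :
    X *m J *m Y^T = 0 -> Y *m J *m X^T = 0.
  by move=> h; apply: trmx_inj; rewrite !trmx_mul trmxK lorentz_form_sym mulmxA h trmx0.
pose M' := castmx (dim_parabolic hr, erefl) (col_mx U (col_mx V T)).
have dimW : (2 * r + (n - 2 * r - 2) = n - 2)%N by lia.
pose W := castmx (dimW, erefl) (col_mx U V).
have oW : W *m J *m W^T = 1%:M.
  rewrite /W castmx_gram tr_col_mx mul_col_mx mul_col_row oU oV UV (sym _ _ _ _ UV).
  by rewrite -scalar_mx_block castmx1.
have WT : W *m J *m T^T = 0.
  by rewrite !mulmx_castl !mul_col_mx UT VT col_mx0 castmx_const.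
have M'E : M' = castmx (dim_Q3 hr, erefl) (col_mx W T).
  exact: (col_mx_cast dimW (dim_parabolic hr) (dim_Q3 hr)).
have gramM' : M' *m J *m M'^T =
    castmx (dim_Q3 hr, dim_Q3 hr) (block_mx 1%:M 0 0 (null_gram R)).
  rewrite M'E castmx_gram tr_col_mx mul_col_mx mul_col_row oW WT (sym _ _ _ _ WT).
  by rewrite gramT.
have Q3tr : (Q3 R)^T *m Q3 R = 1%:M := mulmx1C (Q3_orthogonal R).
pose M := Q3_tr_block R hr *m M'.
(* M' has Gram matrix diag(1, [null_gram]), and Q3^T [null_gram] Q3 is the Lorentz form in dimension
   three. *)
have MJ : M *m J *m M^T = J.
  rewrite /M trmx_mul -!mulmxA (mulmxA M') (mulmxA _ M'^T) gramM'.
  rewrite /Q3_tr_block castmx_tr !mulmx_castmx tr_block_mx !mulmx_block.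
  rewrite !(mulmx0, mul0mx, addr0, add0r, trmx0, trmx1, mulmx1, mul1mx) trmxK.
  rewrite -Q3_gram !mulmxA Q3tr mul1mx -mulmxA Q3tr mulmx1.
  exact: lorentz_form_cast.
have [M_unit PG] := lorentz_group_inv MJ.
exists (invmx M), r, hr, y^T, beta; split=> // [|t].
  rewrite /unit_sphere /=.
  have <- : (y *m y^T) 0 0 = 1 by rewrite yy mxE.
  rewrite mxE.
  by apply: eq_bigr => i _; rewrite !mxE expr2.
have Q3M : Q3_block R hr *m M = M'.
  rewrite /M mulmxA /Q3_block /Q3_tr_block mulmx_castmx mulmx_block.
  rewrite !(mulmx0, mul0mx, addr0, add0r, mulmx1) Q3_orthogonal -scalar_mx_block.
  by rewrite castmx1 mul1mx.
rewrite invmxK -!mulmxA Q3M; apply: (can_inj (mulKmx M_unit)); rewrite mulKVmx //.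
rewrite -mulmxA; congr (_ *m _).
(* The rows of the block are the coordinates of the images of U, V, u, g, f under 1 + (t A + B) /
   (t^2 + 1). The entry 1/2 comes from f B = y V + u / 2. *)
rewrite /parabolic_block mulmx_castlr mulmx_castl; congr castmx.
rewrite !mul_col_mx !mul_row_col betaU !mulmx_simple_curve VA VB uA uB gA gB fA fB.
rewrite !(mul0mx, mul1mx, scaler0, addr0, add0r) trmxK -!scalemxAl.
rewrite !mul_scalar_mx; congr (col_mx _ (col_mx _ (col_mx _ (col_mx _ _)))).
  by rewrite addrC scalerA mulrC.
move: (y *m V) => z; apply/rowP => k; rewrite !mxE.
have q0 : t ^+ 2 + 1 != 0 by rewrite gt_eqF ?sqrD1_gt0.
by field.
Qed.

End NormalForms.

Theorem theorem4p17 (R : realType) (n : nat)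
    (alpha : rational_curve (@lorentz_group R n)) :
  quadratic_with_poles_i alpha ->
  value_at_infty alpha 1%:M ->
  (exists (P : 'M[R]_(n + 1)) (r : nat) (hr : (2 * r <= n)%N)
      (beta : rational_curve (@orthogonal_group R (2 * r))),
     [/\ lorentz_group P,
         ((0 < r)%N -> quadratic_with_poles_i beta),
         \rank (derive1 beta 0) = (2 * r)%N
       & forall t : R,
           alpha t = P *m compact_block hr (beta t) *m invmx P])
  \/
  (exists (P : 'M[R]_(n + 1)) (r : nat) (hr : (2 * r + 3 <= n)%N)
      (y : 'cV[R]_(n - 2 * r - 2))
      (beta : rational_curve (@orthogonal_group R (2 * r))),
     [/\ lorentz_group P,
         unit_sphere y,
         ((0 < r)%N -> quadratic_with_poles_i beta),
         \rank (derive1 beta 0) = (2 * r)%N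
       & forall t : R,
           alpha t = P *m Q3_tr_block R hr *m parabolic_block hr (beta t) y t
                       *m Q3_block R hr *m invmx P]).
Proof.
move=> quad lim; have [A [B alphaE]] := quadratic_curveP quad lim.
set J := lorentz_form R n.
have Jsym : J^T = J by exact: lorentz_form_sym.
have Junit : J \in unitmx by exact: lorentz_form_unit.
have lorentzian := @lorentz_form_lorentzian R n.
have iso t : simple_curve A B t *m J *m (simple_curve A B t)^T = J.
  by have [_] := curve_in_group alpha t; rewrite -alphaE.
have [A_skew K_skew AK KK] := simple_curve_isometry Jsym Junit iso.
set K := B - _ in K_skew AK KK.
have B_def : B = 2^-1 *: (A *m A) + K by rewrite addrC subrK.
have [posA|] := pselect (forall x : 'rV_(n + 1), x *m A != 0 -> 0 < bform J (x *m A) (x *m A)).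
  left.
  have [e [qe eA eK]] := timelike_kernel Jsym Junit lorentzian
    (lorentz_form_timelike R n) A_skew K_skew KK posA.
  have [r [l [U [V [C [D [dimn oUV UE VE UeVe]]]]]]] :=
    compact_frame Jsym lorentzian A_skew K_skew AK KK B_def erefl qe eA eK.
  have [P [r' [hr [beta [PG bquad rk PE]]]]] :=
    compact_normal_form iso dimn oUV UE VE qe eA UeVe.
  by exists P, r', hr, beta; split=> // t; rewrite alphaE.
move=> /existsNP[w /not_implyP[wA /negP]]; rewrite -leNgt => qw; right.
have [r [l [U [V [C [D [u [g [f [y [dimn oUV UE TE rows]]]]]]]]]]] :=
  parabolic_frame Jsym Junit lorentzian A_skew K_skew AK KK B_def wA qw.
have [P [r' [hr [z [beta [PG zz bquad rk PE]]]]]] :=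
  parabolic_normal_form iso dimn oUV UE TE rows.
by exists P, r', hr, z, beta; split=> // t; rewrite alphaE.
Qed.
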